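(* Let $\sigma>0$, $\rho>0$, $\alpha>0$, $m=\lceil\alpha\rceil$, $b_0,\dots,b_{m-1}\in\mathbb{R}$, $h>0$, and let $f:[0,\infty)\times\mathbb{R}\to\mathbb{R}$ be continuous. Then $\psi\in C[0,h]$ is a solution of the initial value problem $$ {}_\sigma^c D_0^{\alpha,\rho}\psi(t)=f(t,\psi(t))\quad (t>0),\qquad {}_\sigma D^{k,\rho}\psi(0)=b_k,\quad k\in\{0,1,\dots,m-1\}, $$ if and only if $\psi\in C[0,h]$ satisfies the Volterra equation $$ \psi(t)=e^{-\sigma t^\rho}\sum_{k=0}^{m-1}\frac{b_k}{\Gamma(k+1)}t^{\rho k}+\frac{\rho}{\Gamma(\alpha)}\int_0^t\frac{e^{-\sigma(t^\rho-s^\rho)}}{(t^\rho-s^\rho)^{1-\alpha}}\,s^{\rho-1}f(s,\psi(s))\,ds . $$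
   Context: Differential operator: ${}_\sigma D^{n,\rho}=\big(\frac{t^{1-\rho}}{\rho}\frac{d}{dt}+\sigma\big)^n$ ($n$-fold composition, ${}_\sigma D^{0,\rho}$ the identity); ${}_\sigma D^{k,\rho}\psi(0)$ denotes its value at $0$, understood as the limit as $t\to0^+$. Generalized substantial operators with lower limit $0$: for $\gamma>0$, ${}_\sigma I_0^{\gamma,\rho}\psi(t)=\frac{\rho}{\Gamma(\gamma)}\int_0^t (t^\rho-s^\rho)^{\gamma-1}e^{-\sigma(t^\rho-s^\rho)}s^{\rho-1}\psi(s)\,ds$, ${}_\sigma I_0^{0,\rho}$ is the identity, and for $m-1<\alpha\le m$, ${}_\sigma D_0^{\alpha,\rho}\psi={}_\sigma D^{m,\rho}\,{}_\sigma I_0^{m-\alpha,\rho}\psi$. The generalized Caputo type substantial derivative is $$ {}_\sigma^c D_0^{\alpha,\rho}\psi(t)={}_\sigma D_0^{\alpha,\rho}\Big(\psi(t)-\sum_{k=0}^{m-1}\frac{{}_\sigma D^{k,\rho}\psi(0)}{k!}\,t^{\rho k}e^{-\sigma t^\rho}\Big). $$ A solution of the initial value problem on $[0,h]$ is a $\psi\in C[0,h]$ for which the expressions in the problem exist, the differential equation holds for $0<t\le h$, and the initial conditions hold. *)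

(* Defs.v *)
From mathcomp Require Import all_boot all_order all_algebra.
From mathcomp Require Import all_classical all_reals all_analysis.

Set Implicit Arguments.
Unset Strict Implicit.
Unset Printing Implicit Defensive.

Import Order.TTheory GRing.Theory Num.Theory.
Import numFieldNormedType.Exports.

Local Open Scope classical_set_scope.
Local Open Scope ring_scope.

Definition Gamma (R : realType) (x : R) : R :=
  \int[lebesgue_measure]_(s in `]0, +oo[) (s `^ (x - 1) * expR (- s)).

(* Functions on [0, h] are represented by total functions R -> R, whose values
   outside [0, h] must not matter.  Difference quotients are therefore taken
   inside ]0, h]: the resulting derivative is the usual two-sided one on
   ]0, h[ and the left derivative at h. *)
Definition diff_quot_lim (R : realType) (h : R) (g : R -> R) (t : R) :
    set_system R :=
  (g s - g t) / (s - t) @[s --> within `]0, h] t^'].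

Definition derivable_in (R : realType) (h : R) (g : R -> R) (t : R) : Prop :=
  cvg (diff_quot_lim h g t).

Definition deriv_in (R : realType) (h : R) (g : R -> R) (t : R) : R :=
  lim (diff_quot_lim h g t).

(* All the operators below are total, with unspecified values where the
   expression they denote is undefined; each comes with a predicate [_ex]
   saying that the expression exists. *)

Definition sD (R : realType) (sigma rho h : R) (n : nat) (g : R -> R) :
    R -> R :=
  iter n (fun u t => t `^ (1 - rho) / rho * deriv_in h u t + sigma * u t) g.

(* The composition is one of partial functions: the (n+1)-st iterate exists at t
   when the n-th one exists around t in ]0, h] and is differentiable at t. *)
Fixpoint sD_ex (R : realType) (sigma rho h : R) (n : nat) (g : R -> R)
    (t : R) : Prop :=
  if n is n'.+1 then
    (\forall s \near within `]0, h] (nbhs t), sD_ex sigma rho h n' g s) /\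
    derivable_in h (sD sigma rho h n' g) t
  else True.

Definition sD_at0 (R : realType) (sigma rho h : R) (n : nat) (g : R -> R) : R :=
  lim (sD sigma rho h n g t @[t --> 0^'+]).

Definition sD_at0_ex (R : realType) (sigma rho h : R) (n : nat) (g : R -> R) :
    Prop :=
  (\forall t \near 0^'+, sD_ex sigma rho h n g t) /\
  cvg (sD sigma rho h n g t @[t --> 0^'+]).

Definition sI_integrand (R : realType) (sigma rho gamma : R) (g : R -> R)
    (t s : R) : R :=
  (t `^ rho - s `^ rho) `^ (gamma - 1) * expR (- sigma * (t `^ rho - s `^ rho))
  * s `^ (rho - 1) * g s.

Definition sI (R : realType) (sigma rho gamma : R) (g : R -> R) (t : R) : R :=
  if gamma == 0 then g t else
  rho / Gamma gamma *
    \int[lebesgue_measure]_(s in `[0, t]) sI_integrand sigma rho gamma g t s.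

Definition sI_ex (R : realType) (sigma rho gamma : R) (g : R -> R) (t : R) :
    Prop :=
  gamma != 0 ->
  lebesgue_measure.-integrable `[0, t]
    (EFin \o sI_integrand sigma rho gamma g t).

Definition frac_order (R : realType) (alpha : R) : nat := `|Num.ceil alpha|%N.

Definition sRL (R : realType) (sigma rho h alpha : R) (g : R -> R) : R -> R :=
  let m := frac_order alpha in
  sD sigma rho h m (sI sigma rho (m%:R - alpha) g).

Definition sRL_ex (R : realType) (sigma rho h alpha : R) (g : R -> R) (t : R) :
    Prop :=
  let m := frac_order alpha in
  (\forall s \near within `]0, h] (nbhs t),
     sI_ex sigma rho (m%:R - alpha) g s) /\
  sD_ex sigma rho h m (sI sigma rho (m%:R - alpha) g) t.

Definition caputo_remainder (R : realType) (sigma rho h alpha : R)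
    (g : R -> R) (t : R) : R :=
  g t - \sum_(k < frac_order alpha)
          sD_at0 sigma rho h k g / (k`!)%:R * t `^ (rho * k%:R)
          * expR (- sigma * t `^ rho).

Definition sCaputo (R : realType) (sigma rho h alpha : R) (g : R -> R) :
    R -> R :=
  sRL sigma rho h alpha (caputo_remainder sigma rho h alpha g).

Definition sCaputo_ex (R : realType) (sigma rho h alpha : R) (g : R -> R)
    (t : R) : Prop :=
  (forall k : 'I_(frac_order alpha), sD_at0_ex sigma rho h k g) /\
  sRL_ex sigma rho h alpha (caputo_remainder sigma rho h alpha g) t.

Definition ivp_solution (R : realType) (sigma rho h alpha : R)
    (b : 'I_(frac_order alpha) -> R) (f : R * R -> R) (psi : R -> R) : Prop :=
  [/\ {within `[0, h], continuous psi},
      forall t, 0 < t <= h ->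
        sCaputo_ex sigma rho h alpha psi t /\
        sCaputo sigma rho h alpha psi t = f (t, psi t)
    & forall k : 'I_(frac_order alpha),
        sD_at0_ex sigma rho h k psi /\ sD_at0 sigma rho h k psi = b k].

(* Main.v *)
Require Import Defs.
From mathcomp Require Import all_boot all_order all_algebra.
From mathcomp Require Import all_classical all_reals all_analysis.
From mathcomp Require Import measurable_realfun ring lra.

Set Implicit Arguments.
Unset Strict Implicit.
Unset Printing Implicit Defensive.

Import Order.TTheory GRing.Theory Num.Theory.
Import numFieldNormedType.Exports.

Local Open Scope classical_set_scope.
Local Open Scope ring_scope.

(** Put [u = t ^ rho] and let [phi u] be [expR (sigma * u) * psi t].  In these
coordinates the substantial operators become the classical ones:
[t ^ (1 - rho) / rho * d/dt + sigma] becomes [d/du], and the generalized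
substantial integral becomes the Riemann-Liouville integral [I^a] with lower
limit [0] (lemmas [sD_unstraighten], [is_derive_straighten_sD] and
[sI_unstraighten]).  Let [p] be the polynomial with [p^(k)(0) = b k] for
[k < m], and [G] the function of [u] that corresponds to [f (t, psi t)].  The
theorem becomes the equivalence between the Caputo problem
[(d/du)^m I^(m - alpha) (phi - p) = G], [phi^(k)(0) = b k] for [k < m], and the
integral equation [phi = p + I^alpha G].

From the integral equation to the differential one ([ivp_of_volterra]): for
[k < m] the order [alpha - k] is positive, so the [k]-th derivative of [phi] is
[p^(k) + I^(alpha - k) G], which tends to [b k] at [0]; and
[I^(m - alpha) I^alpha G = I^m G], whose [m]-th derivative is [G].

Conversely ([volterra_of_ivp]), let [N = phi - p].  The functions
[I^(m - alpha) N] and [I^m G] have the same [m]-th derivative, so they differ by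
a polynomial of degree less than [m].  The initial conditions make [N] a
[o(u^(m - 1))] at [0] by the mean value theorem ([little_o_of_derivatives]);
hence so is [I^(m - alpha) N], while [I^m G] is [O(u^m)].  The polynomial is
therefore [o(u^(m - 1))], that is, zero ([eq0_of_derivatives]).  Thus
[I^(m - alpha) (N - I^alpha G) = 0], and [I^(m - alpha)] is injective on
continuous functions ([rli_inj0]).

Everything rests on the semigroup law [I^a I^b = I^(a + b)] ([rl_semigroup]).
It follows from Tonelli's theorem and from the value of the Beta integral, which
is obtained along the same lines ([egammaM]); derivatives of [I^(a + 1)] are
reduced by it to the fundamental theorem of calculus for [I^1]
([is_derive_rl]), and the injectivity of [I^a] to that of [I^1].  *)

(** * Change of variables on open intervals *)

Lemma is_derive1_continuous (R : realType) (f : R -> R) (x d : R) :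
  is_derive x 1 f d -> {for x, continuous f}.
Proof. by move=> fd; apply/differentiable_continuous/derivable1_diffP; case: fd. Qed.

Section substitution.
Context {R : realType}.
Notation mu := (@lebesgue_measure R).
Implicit Types (F f G : R -> R) (A : set R) (a b : nat -> R).

(** The integrands met below blow up at the ends of the interval.  The change of
variables, valid on segments where everything is continuous, is carried over by
monotone convergence to an open set exhausted by segments. *)
Lemma ge0_integral_subst_exhaustion F f G A a b :
  open A -> {homo a : m n / (m <= n)%N >-> n <= m} ->
  {homo b : m n / (m <= n)%N >-> m <= n} -> (forall n, a n <= b n) ->
  A = \bigcup_n `[a n, b n]%classic ->
  (forall x, A x -> [/\ is_derive x 1 F (f x), {for x, continuous f} & 0 < f x]) ->
  (forall x, A x -> 0 <= G (F x)) ->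
  (forall x, A x -> {for F x, continuous G}) ->
  (\int[mu]_(y in F @` A) (G y)%:E = \int[mu]_(x in A) (G (F x) * f x)%:E)%E.
Proof.
move=> oA da ib ab AE dF G0 cG.
have sA n : `[a n, b n]%classic `<=` A by rewrite AE => x xn; exists n.
have Aab n x : x \in `[a n, b n] -> A x by move=> h; apply: (sA n).
have cF n : {within `[a n, b n], continuous F}.
  apply: continuous_in_subspaceT => x /[!inE] /sA /dF[+ _ _].
  exact: is_derive1_continuous.
have F'E x : A x -> F^`()%classic x = f x.
  by move=> /dF[[_ fE] _ _]; rewrite derive1E.
have Foo n x : x \in `]a n, b n[ -> A x.
  by move=> h; apply: (Aab n); move: x h; exact: subset_itv_oo_cc.
have Fincr n : {in `[a n, b n] &, {homo F : x y / x < y}}.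
  apply: gtr0_derive1_lt_cc => //.
  - by move=> x /Foo /dF[[]].
  - by move=> x /Foo Ax; rewrite F'E//; case: (dF _ Ax).
have aab n : a n \in `[a n, b n] by rewrite in_itv/= lexx ab.
have bab n : b n \in `[a n, b n] by rewrite in_itv/= lexx ab.
have Fab n : F (a n) <= F (b n).
  by have := ab n; rewrite le_eqVlt => /predU1P[->//|h]; rewrite ltW// (Fincr n).
have FA n : F @` `[a n, b n]%classic = `[F (a n), F (b n)]%classic :> set R.
  apply/seteqP; split=> [_ [x /= xab <-]|y yab]; last first.
    have [c cab <-] : exists2 c, c \in `[a n, b n] & F c = y.
      apply: (IVT (ab n) (cF n)).
      by rewrite (min_idPl (Fab n)) (max_idPr (Fab n)).
    by exists c.
  have Fle : {in `[a n, b n] &, {homo F : x y / x <= y}}.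
    by move=> u v un vn; rewrite le_eqVlt => /predU1P[->//|uv]; rewrite ltW// (Fincr n).
  rewrite in_itv/= !Fle//; first by move: xab; rewrite in_itv/= => /andP[].
  by move: xab; rewrite in_itv/= => /andP[].
have cF' x : A x -> {for x, continuous F^`()%classic}.
  move=> Ax; have [_ cf _] := dF _ Ax.
  have nA : \forall z \near x, A z by apply: (@open_nbhs_nbhs _ x A); split.
  rewrite /prop_for /continuous_at F'E//; apply: cvg_trans cf.
  apply: near_eq_cvg; near=> z; rewrite F'E//.
  by near: z; exact: nA.
have cfab n : {within `[F (a n), F (b n)], continuous G}.
  rewrite -FA; apply: continuous_in_subspaceT => _ /[!inE] -[x /sA Ax <-].
  exact: cG.
have step n : (\int[mu]_(y in F @` `[a n, b n]%classic) (G y)%:E =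
    \int[mu]_(x in `[a n, b n]) (G (F x) * f x)%:E)%E.
  have := ab n; rewrite le_eqVlt => /predU1P[abE|abn].
    by rewrite -abE set_itv1 image_set1 !integral_set1.
  rewrite FA integration_by_substitution_increasing//.
  - apply: eq_integral => x /[!inE] /sA Ax; rewrite !fctE; congr (_%:E).
    by rewrite F'E.
  - by move=> x /Foo Ax; exact: cF'.
  - apply/cvg_ex; exists (F^`()%classic (a n)).
    by apply: cvg_at_right_filter; apply: cF'; apply: (Aab n).
  - apply/cvg_ex; exists (F^`()%classic (b n)).
    by apply: cvg_at_left_filter; apply: cF'; apply: (Aab n).
  - split.
    + by move=> x /Foo /dF[[]].
    + apply: cvg_at_right_filter.
      by have [+ _ _] := dF _ (Aab n _ (aab n)); exact: is_derive1_continuous.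
    + apply: cvg_at_left_filter.
      by have [+ _ _] := dF _ (Aab n _ (bab n)); exact: is_derive1_continuous.
have nd : nondecreasing_seq (fun n => `[a n, b n]%classic : set R).
  move=> m n mn; apply/subsetPset => x /=; rewrite !in_itv/= => /andP[ax xb].
  by rewrite (le_trans (da _ _ mn) ax) (le_trans xb (ib _ _ mn)).
have cvg1 : (\int[mu]_(x in `[a n, b n]) (G (F x) * f x)%:E @[n --> \oo] -->
    \int[mu]_(x in A) (G (F x) * f x)%:E)%E.
  rewrite AE; apply: ge0_nondecreasing_set_cvg_integral => //.
  - move=> n; apply/measurable_EFinP.
    apply: subspace_continuous_measurable_fun => //.
    apply: continuous_in_subspaceT => x /[!inE] /sA Ax.
    have [dFx cf _] := dF _ Ax.
    apply: continuousM => //; apply: (@continuous_comp _ _ _ F G); last exact: cG.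
    exact: is_derive1_continuous dFx.
  - move=> n x /sA Ax; rewrite lee_fin mulr_ge0 ?G0//.
    by have [_ _ /ltW] := dF _ Ax.
have cvg2 : (\int[mu]_(y in F @` `[a n, b n]%classic) (G y)%:E @[n --> \oo] -->
    \int[mu]_(y in F @` A) (G y)%:E)%E.
  rewrite AE image_bigcup; apply: ge0_nondecreasing_set_cvg_integral => //.
  - by move=> m n mn; apply/subsetPset; apply: image_subset; apply/subsetPset/nd.
  - by move=> n; rewrite FA.
  - move=> n; apply/measurable_EFinP; rewrite FA.
    exact: subspace_continuous_measurable_fun.
  - by move=> n _ [x /sA Ax <-]; rewrite lee_fin G0.
rewrite (eq_cvg _ _ step) in cvg2.
exact: cvg_unique cvg2 cvg1.
Unshelve. all: by end_near. Qed.

Lemma bigcup_itvoo (l r : R) : l < r ->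
  `]l, r[%classic = \bigcup_n
    `[l + (r - l) / n.+2%:R, r - (r - l) / n.+2%:R]%classic :> set R.
Proof.
move=> lr; have d0 : 0 < r - l by rewrite subr_gt0.
apply/seteqP; split=> [x /=|x [n _] /=]; rewrite !in_itv/= => /andP[lx xr].
  have [m /= hm] : exists m : nat, (r - l) / Num.min (x - l) (r - x) < m.+1%:R.
    exists (Num.truncn ((r - l) / Num.min (x - l) (r - x))).
    exact: truncnS_gt.
  exists m => //=; rewrite in_itv/=.
  have e0 : 0 < Num.min (x - l) (r - x) by rewrite lt_min !subr_gt0 lx.
  have : (r - l) / m.+2%:R < Num.min (x - l) (r - x).
    rewrite ltr_pdivrMr// mulrC -ltr_pdivrMr//.
    by rewrite (lt_trans hm)// ltr_nat.
  rewrite lt_min; set d := _ / m.+2%:R => /andP[h1 h2]; apply/andP; split; lra.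
have h : 0 < (r - l) / n.+2%:R by rewrite divr_gt0.
by rewrite (lt_le_trans _ lx) ?ltrDl// (le_lt_trans xr)// ltrBlDr ltrDl.
Qed.

Lemma bigcup_itvoy (l : R) :
  `]l, +oo[%classic = \bigcup_n `[l + n.+1%:R^-1, l + n.+1%:R]%classic :> set R.
Proof.
apply/seteqP; split=> [x /=|x [n _] /=]; rewrite !in_itv/= ?andbT.
  move=> lx; have d0 : 0 < x - l by rewrite subr_gt0.
  pose m := (Num.truncn (x - l) + Num.truncn (x - l)^-1)%N.
  exists m => //=; rewrite in_itv/=.
  have h1 : x - l < m.+1%:R.
    by rewrite (lt_le_trans (truncnS_gt _))// ler_nat ltnS leq_addr.
  have h2 : (x - l)^-1 < m.+1%:R.
    by rewrite (lt_le_trans (truncnS_gt _))// ler_nat ltnS leq_addl.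
  have h3 : m.+1%:R^-1 < x - l by rewrite invf_plt ?posrE.
  by apply/andP; split; [rewrite -lerBrDl ltW | rewrite -lerBlDl ltW].
have : 0 < n.+1%:R^-1 :> R by rewrite invr_gt0.
by move=> h /andP[+ _]; apply: lt_le_trans; rewrite ltrDl.
Qed.

Lemma ge0_integral_subst_itvoo F f G (l r : R) :
  (forall x, l < x < r ->
    [/\ is_derive x 1 F (f x), {for x, continuous f} & 0 < f x]) ->
  (forall x, l < x < r -> 0 <= G (F x)) ->
  (forall x, l < x < r -> {for F x, continuous G}) ->
  (\int[mu]_(y in F @` `]l, r[) (G y)%:E =
   \int[mu]_(x in `]l, r[) (G (F x) * f x)%:E)%E.
Proof.
have [rl|lr] := leP r l.
  by rewrite set_itv_ge ?bnd_simp -?leNgt// image_set0 !integral_set0.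
move=> dF G0 cG; have d0 : 0 < r - l by rewrite subr_gt0.
have in2 x : `]l, r[%classic x -> l < x < r by rewrite /= in_itv.
have le2 m n : (m <= n)%N -> (r - l) / n.+2%:R <= (r - l) / m.+2%:R.
  by move=> mn; rewrite ler_pM2l// lef_pV2 ?posrE// ler_nat.
apply: (ge0_integral_subst_exhaustion _ _ _ _ (bigcup_itvoo lr)).
- exact: interval_open.
- by move=> m n mn; rewrite lerD2l le2.
- by move=> m n mn; rewrite lerD2l lerN2 le2.
- move=> n; have : (r - l) / n.+2%:R <= (r - l) / 2 by exact: (@le2 0 n).
  by move: (_ / n.+2%:R) => d hd; lra.
- by move=> x /in2; exact: dF.
- by move=> x /in2; exact: G0.
- by move=> x /in2; exact: cG.
Qed.

Lemma ge0_integral_subst_itvoy F f G (l : R) :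
  (forall x, l < x ->
    [/\ is_derive x 1 F (f x), {for x, continuous f} & 0 < f x]) ->
  (forall x, l < x -> 0 <= G (F x)) ->
  (forall x, l < x -> {for F x, continuous G}) ->
  (\int[mu]_(y in F @` `]l, +oo[) (G y)%:E =
   \int[mu]_(x in `]l, +oo[) (G (F x) * f x)%:E)%E.
Proof.
move=> dF G0 cG.
have in2 x : `]l, +oo[%classic x -> l < x by rewrite /= in_itv/= andbT.
apply: (ge0_integral_subst_exhaustion _ _ _ _ (bigcup_itvoy l)).
- exact: interval_open.
- by move=> m n mn; rewrite lerD2l lef_pV2 ?posrE// ler_nat.
- by move=> m n mn; rewrite lerD2l ler_nat.
- by move=> n; rewrite lerD2l (@le_trans _ _ 1)// ?invf_le1 ?ler1n.
- by move=> x /in2; exact: dF.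
- by move=> x /in2; exact: G0.
- by move=> x /in2; exact: cG.
Qed.

End substitution.

(** * Beta integrals and integration on a triangle *)

Section gamma_beta.
Context {R : realType}.
Notation mu := (@lebesgue_measure R).
Local Open Scope ereal_scope.

(** The Gamma and Beta integrals are first taken in the extended reals, where
Tonelli's theorem applies to every nonnegative measurable function; finiteness
is proved afterwards, with the help of the relation between them. *)
Definition egamma (a : R) : \bar R :=
  \int[mu]_(s in `]0%R, +oo[) (s `^ (a - 1) * expR (- s))%:E.

Definition ebeta (a b : R) : \bar R :=
  \int[mu]_(x in `]0%R, 1%R[) ((1 - x) `^ (a - 1) * x `^ (b - 1))%:E.

Lemma continuous_powR_gt0 (p x : R) : (0 < x)%R -> {for x, continuous (@powR R ^~ p)}.
Proof. by move=> x0; exact: (is_derive1_continuous (is_derive1_powR p x0)). Qed.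

(** The bound [r] is arbitrary because the Gamma integral needs [r = +oo] and the
semigroup law a finite [r]. *)
Lemma tonelli_triangle (l : R) (r : itv_bound R) (f : R -> R -> R) :
  measurable_fun [set: R * R] (fun p => f p.1 p.2) ->
  (forall x y, 0 <= f x y)%R ->
  \int[mu]_(x in [set` Interval (BRight l) r])
    \int[mu]_(y in [set` Interval (BRight x) r]) (f x y)%:E =
  \int[mu]_(y in [set` Interval (BRight l) r])
    \int[mu]_(x in `]l, y[) (f x y)%:E.
Proof.
move=> mf f0.
pose c (p : R * R) : bool := (l < p.1)%R && (p.1 < p.2)%R && (p.2 \in Interval -oo%O r).
have mc : measurable [set p | c p].
  rewrite (_ : [set p | c p] = ([set p | (l < p.1)%R] `&` [set p | (p.1 < p.2)%R]) `&`
     (snd @^-1` [set` Interval -oo%O r])); last first.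
    by apply/seteqP; split=> [p /= /andP[/andP[]]|p [[]]]/=; [|rewrite /c => -> -> ->].
  apply: measurableI; first apply: measurableI.
  - rewrite (_ : [set p | _] = fst @^-1` `]l, +oo[%classic); last first.
      by apply/seteqP; split=> p /=; rewrite in_itv/= andbT.
    by rewrite -[X in measurable X]setTI; apply: measurable_fst.
  - rewrite -[X in measurable X]setTI.
    have := @measurable_fun_ltr _ _ R [set: R * R] fst snd measurable_fst measurable_snd.
    by move=> /(_ measurableT [set true]); rewrite /preimage/=; apply.
  - by rewrite -[X in measurable X]setTI; apply: measurable_snd.
pose g (p : R * R) : \bar R := (f p.1 p.2 * (c p)%:R)%:E.
have g0 p : 0 <= g p by rewrite lee_fin mulr_ge0.
have mg : measurable_fun setT g.
  apply/measurable_EFinP; apply: measurable_funM => //.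
  rewrite (_ : (fun p => (c p)%:R) = \1_[set p | c p] :> (_ -> R)).
    exact: measurable_indic.
  by apply/funext => p; rewrite indicE; congr (nat_of_bool _)%:R; apply/esym/asboolb.
transitivity (\int[mu]_x \int[mu]_y g (x, y)).
  rewrite integral_mkcond; apply: eq_integral => x _; rewrite patchE mem_setE.
  case: ifPn => xlr; last first.
    rewrite integral0_eq// => y _; rewrite /g /c/=.
    case: (ltP l x) => [lx|]; last by rewrite mulr0.
    case: (ltP x y) => [xy|]; last by rewrite mulr0.
    case yr : (_ \in _); last by rewrite mulr0.
    exfalso; move/negP: xlr; apply; move: yr; rewrite /= !itv_boundlr /= => yr.
    by rewrite bnd_simp lx/= (le_trans _ yr)// bnd_simp ltW.
  rewrite integral_mkcond; apply: eq_integral => y _; rewrite patchE /g /c/=.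
  have lx : (l < x)%R by move: xlr; rewrite itv_boundlr bnd_simp => /andP[].
  rewrite lx/= mem_setE !itv_boundlr/= bnd_simp.
  by case: ifPn; rewrite ?mulr1 ?mulr0.
transitivity (\int[mu]_y \int[mu]_x g (x, y)).
  exact: (@fubini_tonelli _ _ _ _ R mu mu g mg g0).
rewrite [RHS]integral_mkcond; apply: eq_integral => y _; rewrite patchE mem_setE.
case: ifPn => ylr; last first.
  rewrite integral0_eq// => x _; rewrite /g /c/=.
  case: (ltP l x) => [lx|]; last by rewrite mulr0.
  case: (ltP x y) => [xy|]; last by rewrite mulr0.
  case yr : (_ \in _); last by rewrite mulr0.
  exfalso; move/negP: ylr; apply; move: yr; rewrite /= !itv_boundlr /= => yr.
  by rewrite bnd_simp (lt_trans lx xy).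
rewrite [RHS]integral_mkcond; apply: eq_integral => x _; rewrite patchE /g /c/=.
have -> : y \in Interval -oo%O r by move: ylr; rewrite !itv_boundlr/= => /andP[].
rewrite andbT mem_setE in_itv/=.
by case: ifPn; rewrite ?mulr1 ?mulr0.
Qed.

(** Affine change of variables [v = w + (u - w) * x]. *)
Lemma integral_beta_itv (a b w u : R) : (w < u)%R ->
  \int[mu]_(v in `]w, u[) ((u - v) `^ (a - 1) * (v - w) `^ (b - 1))%:E =
  ((u - w) `^ (a + b - 1))%:E * ebeta a b.
Proof.
move=> wu; have d0 : (0 < u - w)%R by rewrite subr_gt0.
pose F (x : R) : R := (w + (u - w) * x)%R.
have FE : F @` `]0%R, 1%R[%classic = `]w, u[%classic.
  apply/seteqP; split=> [_ [x /= + <-]|v /=]; rewrite !in_itv/= => /andP[h1 h2].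
    by rewrite /F; apply/andP; split; nra.
  exists ((v - w) / (u - w))%R; last by rewrite /F mulrC divfK ?gt_eqF//; lra.
  by rewrite /= in_itv/= divr_gt0 ?subr_gt0//= ltr_pdivrMr// mul1r ltrD2r.
rewrite -FE (@ge0_integral_subst_itvoo _ F (fun=> (u - w)%R)); first last.
- move=> x /andP[x0 x1]; apply: continuousM.
    apply: (@continuous_comp _ _ _ (fun v => u - v)%R (@powR R ^~ (a - 1))%R).
      by apply: continuousB; [exact: cvg_cst|exact: cvg_id].
    by apply: continuous_powR_gt0; rewrite /F; nra.
  apply: (@continuous_comp _ _ _ (fun v => v - w)%R (@powR R ^~ (b - 1))%R).
    by apply: continuousB; [exact: cvg_id|exact: cvg_cst].
  by apply: continuous_powR_gt0; rewrite /F; nra.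
- by move=> x _; rewrite mulr_ge0 ?powR_ge0.
- move=> x _; split => //; last by move=> ?; exact: cvg_cst.
  apply: is_derive_eq.
  by rewrite /GRing.scale/= add0r mul1r mulr1.
rewrite -ge0_integralZl//=; last 3 first.
- apply/measurable_EFinP; apply: measurable_funM.
    apply: (measurableT_comp (measurable_powR _)) => //.
    exact: measurable_funB.
  by apply: measurable_funTS; exact: measurable_powR.
- by move=> x _; rewrite lee_fin mulr_ge0 ?powR_ge0.
- by rewrite lee_fin powR_ge0.
apply: eq_integral => x; rewrite inE/= in_itv/= => /andP[x0 x1].
rewrite -EFinM; congr EFin; rewrite /F.
rewrite (_ : u - (w + (u - w) * x) = (u - w) * (1 - x))%R; last by ring.
rewrite (_ : w + (u - w) * x - w = (u - w) * x)%R; last by ring.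
rewrite !powRM ?(ltW d0) ?(ltW x0) ?subr_ge0 ?(ltW x1)//.
rewrite (_ : a + b - 1 = (a - 1) + (b - 1) + 1)%R; last by ring.
move: (a - 1)%R (b - 1)%R => p q.
by rewrite !powRD ?(gt_eqF d0) ?implybT// powRr1 ?ltW//; ring.
Qed.

End gamma_beta.

(** * Euler's relation between the Beta and Gamma integrals *)

Section gamma_function.
Context {R : realType}.
Notation mu := (@lebesgue_measure R).
Local Open Scope ereal_scope.

Lemma egamma_ge0 (a : R) : 0 <= egamma a.
Proof. by apply: integral_ge0 => x _; rewrite lee_fin mulr_ge0 ?powR_ge0 ?expR_ge0. Qed.

Lemma ebeta_ge0 (a b : R) : 0 <= ebeta a b.
Proof. by apply: integral_ge0 => x _; rewrite lee_fin mulr_ge0 ?powR_ge0. Qed.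

Lemma measurable_gamma_integrand (D : set R) (a : R) :
  measurable_fun D (fun s : R => s `^ (a - 1) * expR (- s))%R.
Proof.
apply: measurable_funM; apply: measurable_funTS; first exact: measurable_powR.
by apply: (measurableT_comp (@measurable_expR R)); exact: oppr_measurable.
Qed.

Lemma egamma_shift (b x : R) :
  \int[mu]_(z in `]x, +oo[) ((z - x) `^ (b - 1) * expR (- (z - x)))%:E = egamma b.
Proof.
have FE : (fun y => y + x)%R @` `]0%R, +oo[%classic = `]x, +oo[%classic.
  apply/seteqP; split=> [_ [y /= + <-]|z /=]; rewrite !in_itv/= !andbT.
    by rewrite ltrDr.
  by move=> xz; exists (z - x)%R; rewrite ?subrK//= in_itv/= andbT subr_gt0.
rewrite -FE (@ge0_integral_subst_itvoy _ _ (fun=> 1%R)); first last.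
- move=> y y0; apply: continuousM.
    apply: (@continuous_comp _ _ _ (fun v => v - x)%R (@powR R ^~ (b - 1))%R).
      by apply: continuousB; [exact: cvg_id|exact: cvg_cst].
    by apply: continuous_powR_gt0; rewrite addrK.
  apply: (@continuous_comp _ _ _ (fun v => - (v - x))%R expR).
    by apply: continuousN; apply: continuousB; [exact: cvg_id|exact: cvg_cst].
  exact: continuous_expR.
- by move=> y _; rewrite mulr_ge0 ?powR_ge0 ?expR_ge0.
- move=> y _; split => //; last by move=> ?; exact: cvg_cst.
  by apply: is_derive_eq; rewrite addr0.
by apply: eq_integral => y _; rewrite addrK mulr1.
Qed.

(** Write the product as a double integral, put [z = x + y], and exchange the
integrations: for fixed [z] the integral over [x] is a Beta integral on
[`]0, z[]. *)
Lemma egammaM (a b : R) : egamma a * egamma b = ebeta a b * egamma (a + b)%R.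
Proof.
rewrite {2}/egamma -ge0_integralZl//=; last 3 first.
- by apply/measurable_EFinP; exact: measurable_gamma_integrand.
- by move=> x _; rewrite lee_fin mulr_ge0 ?powR_ge0 ?expR_ge0.
- exact: egamma_ge0.
pose f x z : R := (x `^ (b - 1) * (z - x) `^ (a - 1) * expR (- z))%R.
have f0 x z : (0 <= f x z)%R by rewrite !mulr_ge0 ?powR_ge0 ?expR_ge0.
have mf : measurable_fun [set: R * R] (fun p => f p.1 p.2).
  apply: measurable_funM; last first.
    apply: (measurableT_comp (@measurable_expR R)).
    exact: (measurableT_comp (@oppr_measurable R _)).
  apply: measurable_funM.
    exact: (measurableT_comp (measurable_powR _)).
  apply: (measurableT_comp (measurable_powR _)) => //.
  exact: measurable_funB.
transitivity (\int[mu]_(x in `]0%R, +oo[) \int[mu]_(z in `]x, +oo[) (f x z)%:E).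
  apply: eq_integral => x _; rewrite -(egamma_shift a x) muleC.
  rewrite -ge0_integralZl//=; last 3 first.
  - apply/measurable_EFinP; apply: measurable_funTS.
    apply: (measurableT_comp (f := fun y : R => y `^ (a - 1) * expR (- y))%R).
      exact: measurable_gamma_integrand.
    exact: measurable_funB.
  - by move=> y _; rewrite lee_fin mulr_ge0 ?powR_ge0 ?expR_ge0.
  - by rewrite lee_fin mulr_ge0 ?powR_ge0 ?expR_ge0.
  apply: eq_integral => z _; rewrite -EFinM; congr EFin; rewrite /f.
  have -> : expR (- z) = (expR (- x) * expR (- (z - x)))%R.
    by rewrite -expRD; congr expR; ring.
  by ring.
rewrite tonelli_triangle//.
transitivity (\int[mu]_(z in `]0%R, +oo[)
    (ebeta a b * (z `^ (a + b - 1) * expR (- z))%:E)).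
  apply: eq_integral => z; rewrite inE/= in_itv/= andbT => z0.
  transitivity (\int[mu]_(x in `]0%R, z[) ((expR (- z))%:E *
      ((z - x) `^ (a - 1) * (x - 0) `^ (b - 1))%:E)).
    apply: eq_integral => x _; rewrite -EFinM; congr EFin.
    by rewrite /f subr0; ring.
  rewrite ge0_integralZl//=; last 2 first.
  - apply/measurable_EFinP; apply: measurable_funTS; apply: measurable_funM;
      apply: (measurableT_comp (measurable_powR _)) => //; exact: measurable_funB.
  - by move=> x _; rewrite lee_fin mulr_ge0 ?powR_ge0.
  rewrite integral_beta_itv// subr0 muleC -muleA muleCA; congr (_ * _).
rewrite ge0_integralZl//=; last 3 first.
- by apply/measurable_EFinP; exact: measurable_gamma_integrand.
- by move=> x _; rewrite lee_fin mulr_ge0 ?powR_ge0 ?expR_ge0.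
- exact: ebeta_ge0.
Qed.

Lemma egamma1 : egamma (1 : R) = 1.
Proof.
transitivity (\int[mu]_(s in `]0%R, +oo[) (expR (- s))%:E).
  by apply: eq_integral => s _; rewrite subrr powRr0 mul1r.
rewrite integral_itv_obnd_cbnd; last first.
  apply/measurable_EFinP; apply: measurable_funTS.
  by apply: (measurableT_comp (@measurable_expR R)); exact: oppr_measurable.
have cexpN : continuous (fun x : R => expR (- x)).
  move=> x; apply: (@continuous_comp _ _ _ (fun v : R => - v)%R expR).
    exact: continuousN.
  exact: continuous_expR.
rewrite (@ge0_continuous_FTC2y _ _ (fun x => - expR (- x))%R _ 0)//.
- by rewrite oppr0 expR0 sub0e EFinN oppeK.
- exact: continuous_subspaceT.
- rewrite -oppr0; apply: cvgN.
  exact: cvgr_expR.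
- by apply: cvg_at_right_filter; apply: cvgN; exact: cexpN.
- move=> x _; rewrite derive1E; apply: derive_val.
  by apply: is_derive_eq; rewrite /GRing.scale/=; ring.
Qed.

(** The substitution [y = x ^ b] turns [b * x ^ (b - 1)] into the constant [1],
which takes care of the singularity at [0] when [b < 1]. *)
Lemma ebeta1 (b : R) : (0 < b)%R -> ebeta 1 b = b^-1%:E.
Proof.
move=> b0.
have FE : (fun x => x `^ b)%R @` `]0%R, 1%R[%classic =
    `]0%R, 1%R[%classic :> set R.
  apply/seteqP; split=> [_ [x /= + <-]|y /=]; rewrite !in_itv/= => /andP[h1 h2].
    have o : (1 `^ b = 1 :> R)%R by rewrite powR1.
    by rewrite powR_gt0//= -[X in (_ < X)%R]o gt0_ltr_powR// nnegrE ltW.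
  exists (y `^ b^-1)%R; last by rewrite -powRrM mulVf ?gt_eqF// powRr1// ltW.
  rewrite /= in_itv/= powR_gt0//=.
  have b'0 : (0 < b^-1)%R by rewrite invr_gt0.
  have o : (1 `^ b^-1 = 1 :> R)%R by rewrite powR1.
  by rewrite -[X in (_ < X)%R]o gt0_ltr_powR// nnegrE ltW.
have : \int[mu]_(y in (fun x => x `^ b)%R @` `]0%R, 1%R[%classic) (1%R : R)%:E = 1.
  by rewrite FE (integral_cst mu)//= ?lebesgue_measure_itv/= lte01 mul1e sube0.
rewrite (@ge0_integral_subst_itvoo _ _
  (fun x => b * x `^ (b - 1))%R (cst 1%R))//; first last.
- by move=> x _; exact: cvg_cst.
- move=> x /andP[x0 _]; split; [exact: is_derive1_powR| |by rewrite mulr_gt0// powR_gt0].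
  by apply: continuousM; [exact: cvg_cst|exact: continuous_powR_gt0].
rewrite /ebeta => h.
have : b%:E * \int[mu]_(x in `]0%R, 1%R[) ((1 - x) `^ (1 - 1) * x `^ (b - 1))%:E = 1.
  rewrite -h -ge0_integralZl//=; last 3 first.
  - apply/measurable_EFinP; apply: measurable_funTS; apply: measurable_funM;
      apply: (measurableT_comp (measurable_powR _)) => //; exact: measurable_funB.
  - by move=> x _; rewrite lee_fin mulr_ge0 ?powR_ge0.
  - by rewrite lee_fin ltW.
  by apply: eq_integral => x _; rewrite subrr powRr0 !mul1r.
move/(congr1 (fun y => b^-1%:E * y)); rewrite muleA -EFinM mulVf ?gt_eqF//.
by rewrite mul1e mule1.
Qed.

Lemma egammaS (a : R) : (0 < a)%R -> egamma (a + 1) = a%:E * egamma a.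
Proof.
move=> a0; have := egammaM 1 a.
rewrite egamma1 mul1e ebeta1// addrC => ->.
by rewrite muleA -EFinM mulfV ?gt_eqF// mul1e.
Qed.

End gamma_function.

(** * Finiteness and values of the Gamma function *)

Section gamma_values.
Context {R : realType}.
Notation mu := (@lebesgue_measure R).

Lemma egamma_nat (n : nat) : egamma (n%:R + 1 : R) = (n`!%:R)%:E.
Proof.
elim: n => [|n ih]; first by rewrite add0r egamma1.
by rewrite egammaS ?ltr0n// -natr1 ih -EFinM natr1 -natrM factS.
Qed.

(** For [a >= 1] the bound [x ^ (a - 1) <= 1 + x ^ n] compares the integral with
two values at integers; smaller [a] follow from the functional equation. *)
Lemma egamma_lty (a : R) : 0 < a -> (egamma a < +oo)%E.
Proof.
suff H (b : R) : 1 <= b -> (egamma b < +oo)%E.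
  move=> a0; have := H (a + 1); rewrite lerDr (ltW a0) egammaS// => /(_ isT) h.
  rewrite -(mul1e (egamma a)) -(@mulVf _ a) ?gt_eqF// EFinM -muleA.
  by rewrite lte_mul_pinfty// lee_fin invr_ge0 ltW.
move=> b1; pose n := Num.truncn b.
have bn : b - 1 <= n%:R.
  by have := truncnS_gt b; rewrite -/n -natr1 lerBlDr => /ltW.
apply: (@le_lt_trans _ _ (egamma (1 : R) + egamma (n%:R + 1 : R))%E); last first.
  by rewrite egamma1 egamma_nat -EFinD ltry.
rewrite /egamma -ge0_integralD//=; last 4 first.
- by move=> x _; rewrite lee_fin mulr_ge0 ?powR_ge0 ?expR_ge0.
- by apply/measurable_EFinP; exact: measurable_gamma_integrand.
- by move=> x _; rewrite lee_fin mulr_ge0 ?powR_ge0 ?expR_ge0.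
- by apply/measurable_EFinP; exact: measurable_gamma_integrand.
apply: ge0_le_integral => //=.
- by move=> x _; rewrite lee_fin mulr_ge0 ?powR_ge0 ?expR_ge0.
- by apply/measurable_EFinP; exact: measurable_gamma_integrand.
- by apply/measurable_EFinP; apply: measurable_funD; exact: measurable_gamma_integrand.
move=> x; rewrite /= in_itv/= andbT => x0.
rewrite -EFinD lee_fin -mulrDl ler_wpM2r ?expR_ge0// subrr powRr0 addrK.
have [x1|x1] := leP x 1.
  rewrite -[leLHS]addr0 lerD ?powR_ge0//.
  by rewrite -[leRHS](powRr0 x) ger_powR ?x0// subr_ge0.
by rewrite -[leLHS]add0r lerD// ler_powR// ltW.
Qed.

Lemma EFin_Gamma (a : R) : 0 < a -> (Gamma a)%:E = egamma a.
Proof.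
by move=> a0; rewrite /Gamma /Rintegral fineK// ge0_fin_numE ?egamma_lty ?egamma_ge0.
Qed.

(** On [`]0, 1[] the integrand is at least [x ^ (a - 1) / e], whose integral is a
Beta value. *)
Lemma Gamma_gt0 (a : R) : 0 < a -> 0 < Gamma a.
Proof.
move=> a0; rewrite -lte_fin EFin_Gamma//.
apply: (@lt_le_trans _ _ ((expR (-1))%:E * ebeta 1 a)%E).
  by rewrite ebeta1// -EFinM lte_fin mulr_gt0 ?expR_gt0 ?invr_gt0.
rewrite /ebeta -ge0_integralZl//=; last 2 first.
- apply/measurable_EFinP; apply: measurable_funTS; apply: measurable_funM;
    apply: (measurableT_comp (measurable_powR _)) => //; exact: measurable_funB.
- by move=> x _; rewrite lee_fin mulr_ge0 ?powR_ge0.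
apply: (@le_trans _ _ (\int[mu]_(s in `]0%R, 1%R[) (s `^ (a - 1) * expR (- s))%:E)%E).
  apply: ge0_le_integral => //=.
  - by move=> x _; rewrite mule_ge0// lee_fin ?expR_ge0// mulr_ge0 ?powR_ge0.
  - apply/measurable_EFinP; apply: measurable_funM => //.
    apply: measurable_funTS; apply: measurable_funM;
    apply: (measurableT_comp (measurable_powR _)) => //; exact: measurable_funB.
  - by apply/measurable_EFinP; exact: measurable_gamma_integrand.
  - move=> x; rewrite /= in_itv/= => /andP[x0 x1].
    rewrite -EFinM lee_fin subrr powRr0 mul1r mulrC ler_wpM2l ?powR_ge0//.
    by rewrite ler_expR lerN2 ltW.
apply: ge0_subset_integral => //=.
- by apply/measurable_EFinP; exact: measurable_gamma_integrand.
- by move=> x _; rewrite lee_fin mulr_ge0 ?powR_ge0 ?expR_ge0.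
- by move=> x /=; rewrite !in_itv/= andbT => /andP[].
Qed.

Lemma GammaS (a : R) : 0 < a -> Gamma (a + 1) = a * Gamma a.
Proof.
move=> a0; apply: EFin_inj; rewrite EFin_Gamma ?addr_gt0// egammaS//.
by rewrite -EFin_Gamma.
Qed.

Lemma Gamma_nat (n : nat) : Gamma (n%:R + 1 : R) = n`!%:R.
Proof.
by apply: EFin_inj; rewrite EFin_Gamma ?egamma_nat// addr_ge0_gt0.
Qed.

Lemma Gamma1 : Gamma (1 : R) = 1.
Proof. by have := Gamma_nat 0; rewrite add0r. Qed.

Lemma ebetaE (a b : R) : 0 < a -> 0 < b ->
  ebeta a b = (Gamma a * Gamma b / Gamma (a + b))%:E.
Proof.
move=> a0 b0; have ab0 : 0 < a + b by rewrite addr_gt0.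
have := egammaM a b; rewrite -!EFin_Gamma// -EFinM => h.
by rewrite EFinM h -muleA -EFinM mulfV ?mule1// gt_eqF// Gamma_gt0.
Qed.

End gamma_values.

(** * The Riemann-Liouville integral *)

Section riemann_liouville.
Context {R : realType}.
Notation mu := (@lebesgue_measure R).
Implicit Types (phi : R -> R) (a b u v : R).

(** An integral is the difference of those of the positive and negative parts, to
which the nonnegative version applies; [f] is positive, so multiplication by it
respects the two parts. *)
Lemma integral_subst_itvoo (F f G : R -> R) (l r : R) :
  (forall x, l < x < r ->
    [/\ is_derive x 1 F (f x), {for x, continuous f} & 0 < f x]) ->
  (forall x, l < x < r -> {for F x, continuous G}) ->
  (\int[mu]_(y in F @` `]l, r[) (G y)%:E =
   \int[mu]_(x in `]l, r[) (G (F x) * f x)%:E)%E.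
Proof.
move=> dF cG.
have maxE (g : R -> R) x : Order.max (g x)%:E 0%E = (Num.max (g x) 0)%:E.
  by rewrite EFin_max.
have H (g : R -> R) : (forall x, l < x < r -> {for F x, continuous g}) ->
  (\int[mu]_(y in F @` `]l, r[) Order.max (g y)%:E 0%E =
   \int[mu]_(x in `]l, r[) Order.max (g (F x) * f x)%:E 0%E)%E.
  move=> cg; transitivity (\int[mu]_(y in F @` `]l, r[) (Num.max (g y) 0)%:E)%E.
    by apply: eq_integral => y _; rewrite maxE.
  rewrite (@ge0_integral_subst_itvoo _ _ f (fun y => Num.max (g y) 0))//.
  - apply: eq_integral => x; rewrite inE/= in_itv/= => /dF[_ _ fx].
    by rewrite (maxE (fun x => g (F x) * f x)) maxr_pMl ?mul0r// ltW.
  - by move=> x _; rewrite le_max lexx orbT.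
  - move=> x /cg cgx; apply: continuous_max; [exact: cgx|exact: cvg_cst].
rewrite [LHS]integralE [RHS]integralE; congr (_ - _)%E.
  under eq_integral do rewrite funeposE.
  by under [RHS]eq_integral do rewrite funeposE; exact: H.
under eq_integral do rewrite funenegE.
under [RHS]eq_integral do rewrite funenegE.
transitivity (\int[mu]_(y in F @` `]l, r[) Order.max (- G y)%:E 0%E)%E.
  by apply: eq_integral => y _; rewrite EFinN.
rewrite (H (fun y => - G y)); last by move=> x /cG cGx; exact: continuousN.
by apply: eq_integral => y _; rewrite mulNr EFinN.
Qed.

(** The Riemann-Liouville integral of order [a] with lower limit [0]. *)
Definition rl a phi u : R :=
  (Gamma a)^-1 * \int[mu]_(v in `]0, u[) ((u - v) `^ (a - 1) * phi v).

Lemma rl_le0 a phi u : u <= 0 -> rl a phi u = 0.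
Proof.
by move=> u0; rewrite /rl set_itv_ge ?bnd_simp -?leNgt// Rintegral_set0 mulr0.
Qed.

Lemma measurable_rl_kernel (D : set R) a u :
  measurable_fun D (fun v => (u - v) `^ (a - 1)).
Proof.
apply: measurable_funTS; apply: (measurableT_comp (measurable_powR _)) => //.
exact: measurable_funB.
Qed.

Lemma integral_rl_kernel a u : 0 < a -> 0 < u ->
  (\int[mu]_(v in `]0%R, u[) ((u - v) `^ (a - 1))%:E = (u `^ a / a)%:E)%E.
Proof.
move=> a0 u0; have := integral_beta_itv a 1 u0.
rewrite subr0 addrK ebetaE// Gamma1 mulr1 GammaS// invfM mulrCA mulrV ?mulr1.
  rewrite EFinM => <-; apply: eq_integral => v _.
  by rewrite subrr powRr0 mulr1.
by rewrite unitfE gt_eqF// Gamma_gt0.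
Qed.

Lemma integrable_rl_kernel a u : 0 < a ->
  mu.-integrable `]0, u[ (fun v => ((u - v) `^ (a - 1))%:E).
Proof.
move=> a0; have [u0|u0] := leP u 0.
  by rewrite set_itv_ge ?bnd_simp -?leNgt//; exact: integrable_set0.
apply/integrableP; split.
  by apply/measurable_EFinP; exact: measurable_rl_kernel.
under eq_integral => v _ do rewrite abse_EFin ger0_norm ?powR_ge0//.
by rewrite integral_rl_kernel// ltry.
Qed.

Lemma continuous_bounded_itv phi (l r : R) : l <= r -> continuous phi ->
  exists2 M : R, 0 <= M & forall v, l <= v <= r -> `|phi v| <= M.
Proof.
move=> lr cphi; have : {within `[l, r], continuous (fun v => `|phi v|)}.
  apply: continuous_subspaceT => v; apply: continuous_comp; first exact: cphi.
  exact: norm_continuous.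
move=> /(EVT_max lr)[c _ hc]; exists (`|phi c|); first by [].
by move=> v vlr; apply: hc; rewrite in_itv.
Qed.

Lemma integrable_rl a phi u : 0 < a -> continuous phi ->
  mu.-integrable `]0, u[ (EFin \o (fun v => (u - v) `^ (a - 1) * phi v)).
Proof.
move=> a0 cphi; have [u0|u0] := leP u 0.
  by rewrite set_itv_ge ?bnd_simp -?leNgt//; exact: integrable_set0.
have [M M0 hM] := continuous_bounded_itv (ltW u0) cphi.
have mI : measurable (`]0, u[%classic : set (measurableTypeR R)) by [].
apply: (le_integrable mI _ _ (integrableZl mI M (integrable_rl_kernel u a0))).
- apply/measurable_EFinP; apply: measurable_funM; first exact: measurable_rl_kernel.
  by apply: measurable_funTS; exact: continuous_measurable_fun.
- move=> v; rewrite /= in_itv/= => /andP[v0 vu].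
  rewrite lee_fin !normrM mulrC ler_wpM2r// (ger0_norm M0) hM//.
  by rewrite !ltW.
Qed.

(** With [v = u * x], the variable [u] leaves the domain of integration and the
singular kernel; continuity in [u] is then a matter of dominated
convergence. *)
Lemma rl_scale a phi u : 0 < a -> continuous phi -> 0 < u ->
  rl a phi u = (Gamma a)^-1 * (u `^ a *
    \int[mu]_(x in `]0, 1[) ((1 - x) `^ (a - 1) * phi (u * x))).
Proof.
move=> a0 cphi u0; congr (_ * _).
have FE : (fun x => u * x) @` `]0, 1[%classic = `]0, u[%classic.
  apply/seteqP; split=> [_ [x /= + <-]|v /=]; rewrite !in_itv/= => /andP[h1 h2].
    by rewrite mulr_gt0//= gtr_pMr.
  exists (v / u); last by rewrite mulrC divfK ?gt_eqF.
  by rewrite /= in_itv/= divr_gt0//= ltr_pdivrMr// mul1r.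
rewrite {1}/Rintegral -FE (@integral_subst_itvoo _ (fun=> u)); first last.
- move=> x /andP[x0 x1]; apply: continuousM; last exact: cphi.
  apply: (@continuous_comp _ _ _ (fun v => u - v) (@powR R ^~ (a - 1))).
    by apply: continuousB; [exact: cvg_cst|exact: cvg_id].
  by apply: continuous_powR_gt0; rewrite subr_gt0 gtr_pMr.
- move=> x _; split => //; last by move=> ?; exact: cvg_cst.
  by apply: is_derive_eq; rewrite /GRing.scale/= mulr1.
rewrite -RintegralZl//; last first.
  have := @integrable_rl a (fun x => phi (u * x)) 1 a0; apply.
  move=> x; apply: continuous_comp; last exact: cphi.
  by apply: continuousM; [exact: cvg_cst|exact: cvg_id].
apply: eq_Rintegral => x; rewrite inE/= in_itv/= => /andP[x0 x1].
rewrite (_ : u - u * x = u * (1 - x)); last by ring.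
rewrite powRM ?(ltW u0) ?subr_ge0 ?(ltW x1)//.
by rewrite -(mulr_powRB1 (ltW u0) a0); ring.
Qed.

Lemma near_eq_continuous_at (f g : R -> R) (x : R) :
  (\near x, f x = g x) -> {for x, continuous g} -> {for x, continuous f}.
Proof.
move=> fg cg; rewrite /prop_for /continuous_at (nbhs_singleton fg).
by apply: cvg_trans cg; apply: near_eq_cvg; near do apply: esym.
Unshelve. all: by end_near. Qed.

Lemma continuous_max0_powR a : 0 < a -> continuous (fun u : R => Num.max u 0 `^ a).
Proof.
move=> a0 u; have [u0|u0|->] := ltgtP u 0.
- apply: (@near_eq_continuous_at _ (cst 0)); last exact: cst_continuous.
  near=> z; have z0 : z <= 0 by near: z; exact: (lt_le_nbhsl u0).
  by rewrite max_r ?powR0 ?gt_eqF.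
- apply: (@near_eq_continuous_at _ (@powR R ^~ a)).
    near=> z; have z0 : 0 <= z by near: z; exact: (lt_le_nbhsr u0).
    by rewrite max_l.
  exact: continuous_powR_gt0.
- apply/left_right_continuousP; rewrite maxxx powR0 ?gt_eqF//; split.
    apply/cvgrPdist_lt => e e0; near=> z.
    by rewrite max_r ?powR0 ?gt_eqF// subr0 normr0.
  have /cvgrPdist_lt h := powR_cvg0 a0.
  apply/cvgrPdist_lt => e /h he; near=> z.
  by rewrite max_l//; near: z.
Unshelve. all: by end_near. Qed.

Lemma rl_scale0 a phi u : 0 < a -> continuous phi ->
  rl a phi u = (Gamma a)^-1 * (Num.max u 0 `^ a *
    \int[mu]_(x in `]0, 1[) ((1 - x) `^ (a - 1) * phi (u * x))).
Proof.
move=> a0 cphi; have [u0|u0] := leP u 0; last exact: rl_scale.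
by rewrite rl_le0// powR0 ?gt_eqF// mul0r mulr0.
Qed.

Lemma continuous_rl a phi : 0 < a -> continuous phi -> continuous (rl a phi).
Proof.
move=> a0 cphi u0.
rewrite (_ : rl a phi = fun u => (Gamma a)^-1 * (Num.max u 0 `^ a *
    \int[mu]_(x in `]0, 1[) ((1 - x) `^ (a - 1) * phi (u * x)))); last first.
  by apply/funext => u; rewrite rl_scale0.
have cphiM (u : R) : continuous (fun x => phi (u * x)).
  move=> x; apply: continuous_comp; last exact: cphi.
  by apply: continuousM; [exact: cvg_cst|exact: cvg_id].
have cphiMr (x : R) : continuous (fun u => phi (u * x)).
  move=> u; apply: continuous_comp; last exact: cphi.
  by apply: continuousM; [exact: cvg_id|exact: cvg_cst].
apply: cvgM; first exact: cvg_cst.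
apply: cvgM; first exact: continuous_max0_powR.
have [M M0 hM] := @continuous_bounded_itv phi (- (`|u0| + 1)) (`|u0| + 1)
  ltac:(by have := normr_ge0 u0; lra) cphi.
have m01 : measurable (`]0, 1[%classic : set (measurableTypeR R)) by [].
apply: (@continuity_under_integral _ _ _ mu
  (fun u x => (1 - x) `^ (a - 1) * phi (u * x)) _ m01 (u0 - 1) (u0 + 1)
   _ _ (fun x => M * (1 - x) `^ (a - 1))).
- by move=> u _; exact: integrable_rl.
- apply: aeW => x _ u _; apply: cvgM; first exact: cvg_cst.
  exact: cphiMr.
- exact: (integrableZl m01 M (integrable_rl_kernel 1 a0)).
- move=> u; rewrite /= in_itv/= => hu; apply: aeW => x /=.
  rewrite in_itv/= => /andP[x0 x1].
  rewrite normrM ger0_norm ?powR_ge0// mulrC ler_wpM2r ?powR_ge0// hM// -ler_norml.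
  rewrite normrM (gtr0_norm x0).
  apply: (@le_trans _ _ `|u|); first by rewrite ler_piMr// ltW.
  rewrite -lerBlDl; apply: le_trans (lerB_dist _ _) _.
  by rewrite ler_norml; apply/andP; split; lra.
- by rewrite inE/= in_itv/=; apply/andP; split; lra.
Unshelve. all: by end_near. Qed.

Lemma rlB a phi chi u : 0 < a -> continuous phi -> continuous chi ->
  rl a (fun v => phi v - chi v) u = rl a phi u - rl a chi u.
Proof.
move=> a0 cphi cchi; rewrite /rl -mulrBr -RintegralB//; [|exact: integrable_rl..].
by congr (_ * _); apply: eq_Rintegral => v _; rewrite mulrBr.
Qed.

Lemma eq_rl a phi chi u : (forall v, 0 < v < u -> phi v = chi v) ->
  rl a phi u = rl a chi u.
Proof.
move=> h; congr (_ * _); apply: eq_Rintegral => v; rewrite inE/= in_itv/= => hv.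
by rewrite h.
Qed.

End riemann_liouville.

(** * Semigroup law, differentiation and injectivity *)

Section riemann_liouville_semigroup.
Context {R : realType}.
Notation mu := (@lebesgue_measure R).
Implicit Types (phi : R -> R) (a b u v : R).

Lemma EFin_rl a phi u : 0 < a -> continuous phi ->
  (rl a phi u)%:E = ((Gamma a)^-1%:E *
    \int[mu]_(v in `]0%R, u[) ((u - v) `^ (a - 1) * phi v)%:E)%E.
Proof.
move=> a0 cphi; rewrite /rl EFinM; congr (_ * _)%E.
rewrite /Rintegral fineK//.
have m0u : measurable (`]0, u[%classic : set (measurableTypeR R)) by [].
exact: (integrable_fin_num m0u (integrable_rl _ a0 cphi)).
Qed.

(** After exchanging the integrations, the inner one is a Beta integral. *)
Lemma rl_semigroup_ge0 a b phi u : 0 < a -> 0 < b -> continuous phi ->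
  (forall v, 0 <= phi v) -> rl a (rl b phi) u = rl (a + b) phi u.
Proof.
move=> a0 b0 cphi phi0; have [u0|u0] := leP u 0; first by rewrite !rl_le0.
have ab0 : 0 < a + b by rewrite addr_gt0.
have mphi : measurable_fun setT phi by exact: continuous_measurable_fun.
apply: EFin_inj; rewrite (EFin_rl u a0 (continuous_rl b0 cphi)) (EFin_rl u ab0 cphi).
have m0 x : measurable (`]0, x[%classic : set (measurableTypeR R)) by [].
pose f w v : R := (Gamma b)^-1 * ((u - v) `^ (a - 1) * (v - w) `^ (b - 1) * phi w).
have f0 w v : 0 <= f w v.
  by rewrite /f mulr_ge0 ?invr_ge0 ?(ltW (Gamma_gt0 b0))// !mulr_ge0 ?powR_ge0.
have mf : measurable_fun [set: R * R] (fun p => f p.1 p.2).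
  apply: measurable_funM => //; apply: measurable_funM; last first.
    exact: (measurableT_comp mphi).
  apply: measurable_funM;
    apply: (measurableT_comp (measurable_powR _)) => //; exact: measurable_funB.
transitivity ((Gamma a)^-1%:E *
   \int[mu]_(v in `]0%R, u[) \int[mu]_(w in `]0%R, v[) (f w v)%:E)%E.
  congr (_ * _)%E; apply: eq_integral => v _.
  rewrite EFinM (EFin_rl v b0 cphi) muleCA -(integralZl (m0 v) (integrable_rl _ b0 cphi)).
  rewrite -integralZl//; last first.
    exact: (integrableZl (m0 v) _ (integrable_rl _ b0 cphi)).
  by apply: eq_integral => w _; rewrite -!EFinM /f !mulrA.
rewrite -(tonelli_triangle _ (BLeft u) mf f0).
pose K := (Gamma b)^-1 * (Gamma a * Gamma b / Gamma (a + b)).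
transitivity ((Gamma a)^-1%:E *
   \int[mu]_(w in `]0%R, u[) (K%:E * ((u - w) `^ (a + b - 1) * phi w)%:E))%E.
  congr (_ * _)%E; apply: eq_integral => w; rewrite inE/= in_itv/= => /andP[w0 wu].
  transitivity (\int[mu]_(v in `]w, u[) (((Gamma b)^-1 * phi w)%:E *
      ((u - v) `^ (a - 1) * (v - w) `^ (b - 1))%:E))%E.
    by apply: eq_integral => v _; rewrite -EFinM /f; congr EFin; ring.
  rewrite ge0_integralZl//=.
  - rewrite (integral_beta_itv a b wu) (ebetaE a0 b0) -!EFinM; congr EFin; rewrite /K.
    by move: (Gamma a) (Gamma b) (Gamma (a + b)) => x y z; ring.
  - apply/measurable_EFinP; apply: measurable_funTS; apply: measurable_funM;
      apply: (measurableT_comp (measurable_powR _)) => //; exact: measurable_funB.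
  - by move=> v _; rewrite lee_fin mulr_ge0 ?powR_ge0.
  - by rewrite lee_fin mulr_ge0// invr_ge0 ltW// Gamma_gt0.
rewrite (integralZl (m0 u) (integrable_rl _ ab0 cphi)) muleA -EFinM.
congr (_%:E * _)%E; rewrite /K.
move: (Gamma_gt0 a0) (Gamma_gt0 b0) (Gamma_gt0 ab0).
move: (Gamma a) (Gamma b) (Gamma (a + b)) => x y z x0 y0 z0.
by field; rewrite !gt_eqF.
Qed.

Lemma rl_semigroup a b phi u : 0 < a -> 0 < b -> continuous phi ->
  rl a (rl b phi) u = rl (a + b) phi u.
Proof.
move=> a0 b0 cphi; have ab0 : 0 < a + b by rewrite addr_gt0.
(* Both sides are linear in phi, so its positive and negative parts suffice. *)
pose p v := Num.max (phi v) 0; pose n v := Num.max (- phi v) 0.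
have c0 : continuous (cst 0 : R -> R) by exact: cst_continuous.
have cNphi : continuous (fun v => - phi v) by move=> v; apply: cvgN; exact: cphi.
have cp : continuous p by move=> v; exact: (continuous_max (cphi v) (c0 v)).
have cn : continuous n by move=> v; exact: (continuous_max (cNphi v) (c0 v)).
have phiE : phi = fun v => p v - n v.
  apply/funext => v; rewrite /p /n; have [h|h] := leP (phi v) 0.
    by rewrite max_l ?oppr_ge0// sub0r opprK.
  by rewrite max_r ?oppr_le0 ?ltW// subr0.
have p0 v : 0 <= p v by rewrite le_max lexx orbT.
have n0 v : 0 <= n v by rewrite le_max lexx orbT.
rewrite phiE (rlB _ ab0)// -!rl_semigroup_ge0// -rlB//; try exact: continuous_rl.
by congr rl; apply/funext => v; rewrite rlB.
Qed.

Lemma rl1E phi u : continuous phi ->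
  rl 1 phi u = \int[mu]_(v in `[0, u]) phi v.
Proof.
move=> cphi; rewrite /rl Gamma1 invr1 mul1r /Rintegral; congr fine.
rewrite [RHS]integral_itv_bndoo; last first.
  by apply/measurable_EFinP; apply: measurable_funTS; exact: continuous_measurable_fun.
by apply: eq_integral => v _; rewrite subrr powRr0 mul1r.
Qed.

Lemma is_derive_rl1 phi u : continuous phi -> 0 < u ->
  is_derive u 1 (rl 1 phi) (phi u).
Proof.
move=> cphi u0.
have -> : rl 1 phi = fun x => \int[mu]_(v in `[0, x]) phi v.
  by apply/funext => x; rewrite rl1E.
have uu1 : u < u + 1 by rewrite ltrDl.
have [||d dE] := @continuous_FTC1_closed R phi 0 u (u + 1) uu1 _ u0.
- apply: continuous_compact_integrable; first exact: segment_compact.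
  exact: continuous_subspaceT.
- exact: cphi.
by apply: DeriveDef; [exact: d|rewrite -derive1E; exact: dE].
Qed.

(** Since [I^(a + 1) = I^1 I^a] and [I^a phi] is continuous, this is the
fundamental theorem of calculus; the singular kernel is never
differentiated. *)
Lemma is_derive_rl a phi u : 0 < a -> continuous phi -> 0 < u ->
  is_derive u 1 (rl (a + 1) phi) (rl a phi u).
Proof.
move=> a0 cphi u0.
have -> : rl (a + 1) phi = rl 1 (rl a phi).
  by apply/funext => x; rewrite (rl_semigroup x ltr01 a0 cphi) (addrC 1).
by apply: is_derive_rl1 => //; exact: continuous_rl.
Qed.

Lemma norm_rl_le a phi u (C : R) : 0 < a -> continuous phi -> 0 < u ->
  (forall v, 0 < v < u -> `|phi v| <= C) ->
  `|rl a phi u| <= C * (u `^ a / Gamma (a + 1)).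
Proof.
move=> a0 cphi u0 hC.
have m0 : measurable (`]0, u[%classic : set (measurableTypeR R)) by [].
have iC := integrableZl m0 C (integrable_rl_kernel u a0).
have iphi := integrable_rl u a0 cphi.
rewrite /rl normrM gtr0_norm ?invr_gt0 ?Gamma_gt0//.
have -> : C * (u `^ a / Gamma (a + 1)) = (Gamma a)^-1 * (C * (u `^ a / a)).
  by rewrite GammaS// invfM; ring.
rewrite ler_pM2l ?invr_gt0 ?Gamma_gt0//.
apply: le_trans (le_normr_Rintegral m0 iphi) _.
have -> : C * (u `^ a / a) = \int[mu]_(v in `]0, u[) (C * (u - v) `^ (a - 1)).
  rewrite RintegralZl//; last exact: integrable_rl_kernel.
  by rewrite /Rintegral integral_rl_kernel.
apply: le_Rintegral => //.
- exact: (integrable_norm iphi).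
- move=> v; rewrite /= in_itv/= => hv.
  by rewrite normrM ger0_norm ?powR_ge0// mulrC ler_wpM2r ?powR_ge0// hC.
Qed.

(** Applying [I^(1 - a)] shows that the primitive of [phi] vanishes. *)
Lemma rl_inj0 a phi (H : R) : 0 < a < 1 -> continuous phi ->
  (forall u, 0 < u < H -> rl a phi u = 0) -> forall u, 0 < u < H -> phi u = 0.
Proof.
move=> /andP[a0 a1] cphi h u /andP[u0 uH].
have h1 v : v < H -> rl 1 phi v = 0.
  move=> vH; have -> : 1 = (1 - a) + a by ring.
  rewrite -rl_semigroup ?subr_gt0// (@eq_rl _ _ _ (cst 0)).
    rewrite /rl (@eq_Rintegral _ _ _ mu _ (cst 0)) ?Rintegral_cst//= ?mul0r ?mulr0//.
    by move=> w _; rewrite mulr0.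
  by move=> w /andP[w0 wv]; rewrite h// w0 (lt_trans wv).
have [_ <-] := is_derive_rl1 cphi u0.
rewrite -(derive_cst (0 : R) u 1); apply: near_eq_derive.
near=> v; rewrite h1//; near: v; exact: lt_nbhsl.
Unshelve. all: by end_near. Qed.

End riemann_liouville_semigroup.

(** * Derivatives inside a half-open interval *)

Section one_sided_derivatives.
Context {R : realType}.
Implicit Types (g G : R -> R) (h t d : R).

Lemma within_dnbhs_proper h t : 0 < t <= h ->
  ProperFilter (within `]0, h]%classic t^').
Proof.
move=> /andP[t0 th]; apply: Build_ProperFilter_ex => A.
rewrite /within/= => hA.
have : \forall s \near t^'-, A s.
  have lt : \forall s \near t^'-, 0 < s by exact: nbhs_left_gt.
  have hA' : \forall s \near t^'-, s != t -> `]0, h]%classic s -> A s.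
    by apply: (@cvg_within _ (nbhs t)); exact: hA.
  near=> s; have st : s < t by [].
  apply: (near hA' s) => //; rewrite ?lt_eqF//= in_itv/=.
  by rewrite (ltW (lt_le_trans st th)) andbT; near: s.
by move=> /filter_ex.
Unshelve. all: by end_near. Qed.

(** [G] is differentiable on both sides of [t], even at [t = h]: the functions used
for it are defined beyond [h], which makes the end point an ordinary one. *)
Lemma deriv_in_is_derive h g G t d : 0 < t <= h ->
  (forall s, 0 < s <= h -> g s = G s) -> is_derive t 1 G d ->
  derivable_in h g t /\ deriv_in h g t = d.
Proof.
move=> th gG /is_derive1_caratheodory[q [qE cq qt]].
have PF := within_dnbhs_proper th.
suff H : diff_quot_lim h g t --> d.
  by split; [apply/cvg_ex; exists d|exact: cvg_lim].
rewrite -qt; apply: (@cvg_trans _ (q s @[s --> within `]0, h]%classic t^'])).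
  apply: near_eq_cvg; rewrite /dnbhs; do 2 rewrite near_withinE.
  apply: nearW => s st; rewrite /= in_itv/= => hs.
  by rewrite !gG// qE mulfK// subr_eq0.
apply: cvg_trans cq; apply: cvg_app => A; rewrite /within/= /dnbhs /within/=.
by apply: filterS => s As _ _.
Unshelve. all: by end_near. Qed.

Lemma is_derive_deriv_in h g t : 0 < t < h -> derivable_in h g t ->
  is_derive t 1 g (deriv_in h g t).
Proof.
move=> /andP[t0 th] dg; apply/is_derive1_caratheodory.
pose d := deriv_in h g t.
exists (fun s => if s == t then d else (g s - g t) / (s - t)); split.
- move=> s; case: eqVneq => [->|st]; first by rewrite !subrr mulr0.
  by rewrite divfK// subr_eq0.
- apply/continuous_withinNx; rewrite eqxx.
  apply: cvg_trans dg; rewrite /diff_quot_lim => A /= hA.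
  have h0 : \forall s \near t, 0 < s by exact: lt_nbhsr.
  have hh : \forall s \near t, s < h by exact: lt_nbhsl.
  have hA' : \forall s \near t, s != t -> `]0, h]%classic s ->
    A ((g s - g t) / (s - t)) by exact: hA.
  suff : \forall s \near t, s != t ->
    A (if s == t then d else (g s - g t) / (s - t)) by [].
  near=> s => st; rewrite (negbTE st).
  have hs : `]0, h]%classic s.
    by rewrite /= in_itv/=; apply/andP; split; [|apply/ltW]; near: s.
  by apply: (near hA' s).
- by rewrite eqxx.
Unshelve. all: by end_near. Qed.

End one_sided_derivatives.

(** * Reduction of the substantial operators to the classical ones *)

Section transfer.
Context {R : realType}.
Notation mu := (@lebesgue_measure R).
Variables (sigma rho h : R).
Hypothesis rho0 : 0 < rho.
Implicit Types (g phi : R -> R) (t u : R).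

(** The functions [phi] of [u = t ^ rho] and [unstraighten phi] of [t] correspond to
each other when the substantial operators are turned into classical ones;
[straighten] is the inverse correspondence. *)
Definition unstraighten phi t : R := expR (- sigma * t `^ rho) * phi (t `^ rho).

Definition straighten g u : R := expR (sigma * u) * g (u `^ rho^-1).

Lemma is_derive_unstraighten phi t d : 0 < t -> is_derive (t `^ rho) 1 phi d ->
  is_derive t 1 (unstraighten phi)
    (rho * t `^ (rho - 1) * (expR (- sigma * t `^ rho) * d - sigma * unstraighten phi t)).
Proof.
move=> t0 dphi; have dp := is_derive1_powR rho t0.
have de : is_derive t 1 (fun s => expR (- sigma * s `^ rho))
    (expR (- sigma * t `^ rho) * (- sigma * (rho * t `^ (rho - 1)))).
  exact: (@is_derive1_comp _ expR (fun s => - sigma * s `^ rho)).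
apply: is_derive_eq.
by rewrite /GRing.scale/= /unstraighten; ring.
Qed.

Lemma is_derive_straighten g u d : 0 < u -> is_derive (u `^ rho^-1) 1 g d ->
  is_derive u 1 (straighten g)
    (expR (sigma * u) *
      ((u `^ rho^-1) `^ (1 - rho) / rho * d + sigma * g (u `^ rho^-1))).
Proof.
move=> u0 dg; have dp := is_derive1_powR rho^-1 u0.
have de : is_derive u 1 (fun v => expR (sigma * v)) (expR (sigma * u) * sigma).
  apply: (@is_derive1_comp _ expR (fun v => sigma * v)).
  apply: is_derive_eq.
  by rewrite /GRing.scale/= mulr1.
apply: is_derive_eq.
rewrite /GRing.scale/= -powRrM mulrBr mulr1 mulVf ?gt_eqF//; ring.
Qed.

Lemma sD_unstraighten n g (Phi : nat -> R -> R) :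
  (forall k u, (k < n)%N -> 0 < u -> is_derive u 1 (Phi k) (Phi k.+1 u)) ->
  (forall t, 0 < t <= h -> g t = unstraighten (Phi 0%N) t) ->
  forall t, 0 < t <= h ->
    sD_ex sigma rho h n g t /\ sD sigma rho h n g t = unstraighten (Phi n) t.
Proof.
elim: n => [|n ih] dPhi gE t th; first by split => //; exact: gE.
have {}ih := ih (fun k u kn => dPhi k u (ltnW kn)) gE.
have /andP[t0 _] := th.
have dn := is_derive_unstraighten t0 (dPhi n _ (ltnSn n) (powR_gt0 rho t0)).
have [dex dE] := deriv_in_is_derive th (fun s hs => (ih s hs).2) dn.
split.
  split=> //; rewrite near_withinE; apply: nearW => s.
  by rewrite /= in_itv/= => /ih[].
rewrite [LHS]/= -/(sD sigma rho h n g) dE (ih t th).2.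
have tt : t `^ (1 - rho) * t `^ (rho - 1) = 1.
  rewrite -powRD ?(gt_eqF t0) ?implybT//.
  by rewrite (_ : 1 - rho + (rho - 1) = 0) ?powRr0//; ring.
set x := expR _ * _; set y := sigma * _.
transitivity ((t `^ (1 - rho) * t `^ (rho - 1)) * (x - y) + y); last first.
  by rewrite tt mul1r subrK.
by field; rewrite gt_eqF.
Qed.

Lemma powR_invK u : 0 <= u -> (u `^ rho^-1) `^ rho = u.
Proof. by move=> u0; rewrite -powRrM mulVf ?gt_eqF// powRr1. Qed.

Lemma powRK t : 0 <= t -> (t `^ rho) `^ rho^-1 = t.
Proof. by move=> t0; rewrite -powRrM mulfV ?gt_eqF// powRr1. Qed.

Lemma powR_inv_itv u : 0 < u < h `^ rho -> 0 <= h -> 0 < u `^ rho^-1 < h.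
Proof.
move=> /andP[u0 uh] h0; rewrite powR_gt0//= -[ltRHS]powRK//.
by rewrite gt0_ltr_powR ?invr_gt0// nnegrE ?powR_ge0// ltW.
Qed.

(** Only interior points occur in this direction: the identities derived from it
extend to the end point by continuity. *)
Lemma is_derive_straighten_sD n g u : 0 <= h -> 0 < u < h `^ rho ->
  sD_ex sigma rho h n.+1 g (u `^ rho^-1) ->
  is_derive u 1 (straighten (sD sigma rho h n g)) (straighten (sD sigma rho h n.+1 g) u).
Proof.
move=> h0 uh [_ dex]; have /andP[u0 _] := uh.
exact: (is_derive_straighten u0 (is_derive_deriv_in (powR_inv_itv uh h0) dex)).
Qed.

(** Change of variables [v = s ^ rho]. *)
Lemma sI_unstraighten gam phi g t : 0 < gam -> continuous phi ->
  (forall s, 0 < s <= h -> g s = unstraighten phi s) -> 0 <= t <= h ->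
  mu.-integrable `[0, t] (EFin \o sI_integrand sigma rho gam g t) /\
  rho / Gamma gam * \int[mu]_(s in `[0, t]) sI_integrand sigma rho gam g t s =
  unstraighten (rl gam phi) t.
Proof.
move=> gam0 cphi gE /andP[t0 th].
pose k v := (t `^ rho - v) `^ (gam - 1) * phi v.
have FE : (fun s => s `^ rho) @` `]0, t[%classic = `]0, t `^ rho[%classic :> set R.
  apply/seteqP; split=> [_ [x /= + <-]|y /=]; rewrite !in_itv/= => /andP[h1 h2].
    by rewrite powR_gt0//= gt0_ltr_powR// nnegrE// ltW.
  exists (y `^ rho^-1); last by rewrite powR_invK// ltW.
  rewrite /= in_itv/= powR_gt0//= -[ltRHS]powRK// gt0_ltr_powR ?invr_gt0//.
    by rewrite nnegrE ltW.
  by rewrite nnegrE powR_ge0.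
have dF x : 0 < x < t -> [/\ is_derive x 1 (@powR R ^~ rho) (rho * x `^ (rho - 1)),
    {for x, continuous (fun x => rho * x `^ (rho - 1))} & 0 < rho * x `^ (rho - 1)].
  move=> /andP[x0 _]; split; [exact: is_derive1_powR| |by rewrite mulr_gt0// powR_gt0].
  by apply: cvgM; [exact: cvg_cst|exact: continuous_powR_gt0].
have ck x : 0 < x < t -> {for x `^ rho, continuous k}.
  move=> /andP[x0 xt]; apply: cvgM; last exact: cphi.
  apply: (@continuous_comp _ _ _ (fun v => t `^ rho - v) (@powR R ^~ (gam - 1))).
    by apply: continuousB; [exact: cvg_cst|exact: cvg_id].
  by apply: continuous_powR_gt0; rewrite subr_gt0 gt0_ltr_powR// nnegrE// ltW.
have cnk x : 0 < x < t -> {for x `^ rho, continuous (fun v => `|k v|)}.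
  by move=> /ck ckx; apply: cvg_norm.
(* K is the integrand of the classical integral after the substitution, and c
   collects the factors that do not depend on s. *)
pose c := expR (- sigma * t `^ rho) / rho.
pose K s := k (s `^ rho) * (rho * s `^ (rho - 1)).
have gK s : 0 < s < t -> sI_integrand sigma rho gam g t s = c * K s.
  move=> /andP[s0 st]; rewrite /sI_integrand gE ?s0 ?(le_trans (ltW st))//.
  rewrite /c /K /k /unstraighten.
  have -> : expR (- sigma * t `^ rho) =
      expR (- sigma * (t `^ rho - s `^ rho)) * expR (- sigma * s `^ rho).
    by rewrite -expRD; congr expR; ring.
  by field; rewrite gt_eqF.
have m0t : measurable (`]0, t[%classic : set (measurableTypeR R)) by [].
have m0T : measurable (`]0, t `^ rho[%classic : set (measurableTypeR R)) by [].
have ik : mu.-integrable `]0, t `^ rho[ (EFin \o k) by exact: integrable_rl.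
have mK : measurable_fun `]0, t[ K.
  apply: open_continuous_measurable_fun; first exact: interval_open.
  move=> x; rewrite inE/= in_itv/= => hx; have [dFx cf _] := dF x hx.
  apply: cvgM; last exact: cf.
  apply: (@continuous_comp _ _ _ (@powR R ^~ rho) k); last exact: ck.
  exact: is_derive1_continuous dFx.
have iK : mu.-integrable `]0, t[ (EFin \o K).
  apply/integrableP; split; first exact/measurable_EFinP.
  have /integrableP[_] := ik.
  rewrite -FE (@ge0_integral_subst_itvoo _ _ _ (fun v => `|k v|) _ _ dF _ cnk).
  - suff -> : (\int[mu]_(x in `]0%R, t[) `|(EFin \o K) x| =
      \int[mu]_(x in `]0%R, t[) (`|k (x `^ rho)| * (rho * x `^ (rho - 1)))%:E)%E by [].
    apply: eq_integral => x; rewrite inE/= in_itv/= => /dF[_ _ p].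
    by rewrite /K normrM (gtr0_norm p).
  - by move=> x _; exact: normr_ge0.
have ig : mu.-integrable `]0, t[ (EFin \o sI_integrand sigma rho gam g t).
  apply: (eq_integrable m0t _ _ _ (integrableZl m0t c iK)).
  by move=> s; rewrite inE/= in_itv/= => /gK ->.
split.
  have /integrableP[mg ig_lty] := ig.
  apply/integrableP; split; first exact: emeasurable_fun_itv_cc mg.
  by rewrite integral_itv_bndoo//; exact: measurableT_comp.
rewrite /Rintegral integral_itv_bndoo; last by have /integrableP[] := ig.
rewrite (@eq_integral _ _ _ mu _ (fun s => c%:E * (K s)%:E)%E); last first.
  by move=> s; rewrite inE/= in_itv/= => /gK ->; rewrite EFinM.
rewrite (integralZl m0t iK) -(integral_subst_itvoo dF ck) FE.
rewrite /unstraighten /rl /Rintegral -/k.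
have := integrable_fin_num m0T ik.
rewrite /comp; case: (\int[mu]_(v in _) _)%E => // r _ /=.
by rewrite /c; field; rewrite !gt_eqF// Gamma_gt0.
Qed.
End transfer.

(** * Order of vanishing at the origin *)

Section vanishing_order.
Context {R : realType}.
Implicit Types (f df : R -> R) (p q : {poly R}) (H u v : R) (N W : nat -> R -> R).

Definition little_o_pow (n : nat) f : Prop :=
  forall e : R, 0 < e -> \forall u \near 0^'+, `|f u| <= e * u ^+ n.

Lemma eq0_itv_closure (D : R -> R) (H u : R) : 0 < H -> continuous D ->
  (forall v, 0 < v < H -> D v = 0) -> 0 <= u <= H -> D u = 0.
Proof.
move=> H0 cD D0 /andP[]; rewrite le_eqVlt => /predU1P[<- _|u0].
  apply/eqP; rewrite -normr_le0; apply/ler_addgt0Pr => e e0; rewrite add0r.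
  have : D v @[v --> (0 : R)^'+] --> D 0 by apply: cvg_at_right_filter; exact: cD.
  move=> /cvgrPdist_le /(_ e e0) h1; near (0 : R)^'+ => v.
  have Dv : D v = 0.
    by apply: D0; apply/andP; split => //; near: v; exact: nbhs_right_lt.
  have -> : D 0 = D 0 - D v by rewrite Dv subr0.
  by near: v.
rewrite le_eqVlt => /predU1P[->|uH]; last by rewrite D0// u0.
apply/eqP; rewrite -normr_le0; apply/ler_addgt0Pr => e e0; rewrite add0r.
have : D v @[v --> H^'-] --> D H by apply: cvg_at_left_filter; exact: cD.
move=> /cvgrPdist_le /(_ e e0) h1; near H^'- => v.
have Dv : D v = 0.
  by apply: D0; apply/andP; split => //; near: v; exact: nbhs_left_gt.
have -> : D H = D H - D v by rewrite Dv subr0.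
by near: v.
Unshelve. all: by end_near. Qed.

Lemma little_oB n (f g : R -> R) : little_o_pow n f -> little_o_pow n g ->
  little_o_pow n (fun u => f u - g u).
Proof.
move=> fo go e e0; have e2 : 0 < e / 2 by rewrite divr_gt0.
apply: filterS2 (fo _ e2) (go _ e2) => u fu gu.
apply: le_trans (ler_normB _ _) _; rewrite [in leRHS](splitr e) mulrDl.
exact: lerD.
Qed.

Lemma eq_little_o n (f g : R -> R) : (\forall u \near 0^'+, f u = g u) ->
  little_o_pow n f -> little_o_pow n g.
Proof. by move=> fg fo e /fo; apply: filterS2 fg => u ->. Qed.

Lemma mvt_itvoo f df H u v : 0 < v -> v < u -> u < H ->
  (forall w, 0 < w < H -> is_derive w 1 f (df w)) ->
  exists2 c, v < c < u & f u - f v = df c * (u - v).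
Proof.
move=> v0 vu uH dfE.
have [c|c|c cvu ->] := @MVT R f df v u vu.
- by rewrite in_itv/= => /andP[vc cu]; apply: dfE; rewrite (lt_trans v0)// (lt_trans cu).
- apply: continuous_in_subspaceT => w; rewrite inE/= in_itv/= => /andP[vw wu].
  apply: is_derive1_continuous; apply: dfE.
  by rewrite (lt_le_trans v0)// (le_lt_trans wu).
- by exists c.
Qed.

(** The last function [N n] is only known to have a limit at [0], not to be
integrable; the mean value theorem is used at each step instead of an
integral remainder. *)
Lemma little_o_of_derivatives n N H : 0 < H ->
  (forall k u, (k < n)%N -> 0 < u < H -> is_derive u 1 (N k) (N k.+1 u)) ->
  (forall k, (k <= n)%N -> N k u @[u --> 0^'+] --> 0) ->
  little_o_pow n (N 0%N).
Proof.
move=> H0; elim: n N => [|n ih] N dN N0 e e0.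
  have /cvgrPdist_le /(_ e e0) := N0 0%N (leqnn _).
  by apply: filterS => u; rewrite sub0r normrN expr0 mulr1.
have /(_ e e0) := ih (fun k => N k.+1) (fun k u kn => dN k.+1 u kn)
  (fun k kn => N0 k.+1 kn).
move=> [d' /= d0' hd]; pose d : R := d'; have d0 : 0 < d := d0'; near=> u.
have u0 : 0 < u by [].
have ud : u < d by near: u; exact: nbhs_right_lt.
have uH : u < H by near: u; exact: nbhs_right_lt.
apply/ler_addgt0Pr => e' e'0.
have [v [v0 vu vle]] : exists v, [/\ 0 < v, v < u & `|N 0%N v| <= e'].
  have /cvgrPdist_le /(_ e' e'0) h := N0 0%N (leq0n _).
  have : \forall v \near 0^'+, [/\ 0 < v, v < u & `|N 0%N v| <= e'].
    near=> v; split; first by [].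
      by near: v; exact: nbhs_right_lt.
    by rewrite -normrN -sub0r; near: v.
  by move=> /filter_ex.
have [c /andP[vc cu] cE] := mvt_itvoo v0 vu uH (fun w => dN 0%N w (ltn0Sn _)).
have c0 : 0 < c by exact: lt_trans vc.
have -> : N 0%N u = (N 0%N u - N 0%N v) + N 0%N v by rewrite subrK.
apply: le_trans (ler_normD _ _) _; apply: lerD => //.
rewrite cE normrM exprSr mulrA; apply: ler_pM => //.
  apply: (@le_trans _ _ (e * c ^+ n)).
    apply: (hd c) => //=; rewrite sub0r normrN gtr0_norm//.
    exact: lt_trans ud.
  by rewrite ler_pM2l// lerXn2r ?nnegrE// ltW.
by rewrite gtr0_norm ?subr_gt0// gerBl ltW.
Unshelve. all: by end_near. Qed.

Lemma poly_antiderivative q n : (size q <= n)%N ->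
  exists2 p : {poly R}, (size p <= n.+1)%N & p^`() = q.
Proof.
move=> qn; exists (\poly_(i < n.+1) (q`_i.-1 / i%:R)); first exact: size_poly.
apply/polyP => i; rewrite coef_deriv coef_poly ltnS.
case: ltnP => [iltn|nlei]; last by rewrite mul0rn nth_default// (leq_trans qn).
by rewrite /= -[LHS]mulr_natr divfK// pnatr_eq0.
Qed.

Lemma poly_of_derivatives n W H : 0 < H ->
  (forall k u, (k < n)%N -> 0 < u < H -> is_derive u 1 (W k) (W k.+1 u)) ->
  (forall u, 0 < u < H -> W n u = 0) ->
  exists2 p : {poly R}, (size p <= n)%N & forall u, 0 < u < H -> W 0%N u = p.[u].
Proof.
move=> H0; elim: n W => [|n ih] W dW Wn.
  by exists 0 => [|u /Wn ->]; rewrite ?size_poly0// horner0.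
have [q qn qE] := ih (fun k => W k.+1) (fun k u kn => dW k.+1 u kn) Wn.
have [p pn pE] := poly_antiderivative qn.
pose u0 := H / 2; pose c := W 0%N u0 - p.[u0].
have u0H : 0 < u0 < H by apply/andP; split; rewrite /u0; lra.
exists (p + c%:P).
  by rewrite (leq_trans (size_polyD _ _))// geq_max pn (leq_trans (size_polyC_leq1 _)).
have dz u : 0 < u < H -> is_derive u 1 (fun v => W 0%N v - p.[v]) 0.
  move=> uH; have dWu := dW 0%N u isT uH; have dp := is_derive_poly p u.
  apply: is_derive_eq.
  by rewrite pE qE// subrr.
move=> u uH; rewrite hornerD hornerC /c.
suff -> : W 0%N u0 - p.[u0] = W 0%N u - p.[u] by rewrite addrC subrK.
have /andP[h1 h2] := uH; have /andP[h3 h4] := u0H.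
have [uu0|u0u|->//] := ltgtP u u0.
  have [c' _] := mvt_itvoo h1 uu0 h4 dz.
  by rewrite mul0r => /eqP; rewrite subr_eq0 => /eqP.
have [c' _] := mvt_itvoo h3 u0u h2 dz.
by rewrite mul0r => /eqP; rewrite subr_eq0 => /eqP.
Qed.

(** Such a [p] vanishes at [0]; divide it by ['X] and lower [n]. *)
Lemma little_o_poly0 n p : (size p <= n.+1)%N -> little_o_pow n (horner p) -> p = 0.
Proof.
elim: n p => [|n ih] p pn op.
  suff c0 : p`_0 = 0 by rewrite (size1_polyC pn) c0.
  apply/eqP; rewrite -normr_le0; apply/ler_addgt0Pr => e e0.
  near (0 : R)^'+ => u.
  have : `|p.[u]| <= e * u ^+ 0 by near: u; exact: op.
  by rewrite {1}(size1_polyC pn) hornerC expr0 mulr1 add0r.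
have p0 : root p 0.
  rewrite /root -normr_le0; apply/ler_addgt0Pr => e e0; rewrite add0r.
  have e2 : 0 < e / 2 by rewrite divr_gt0.
  have cp : p.[u] @[u --> 0^'+] --> p.[0].
    by apply: cvg_at_right_filter; exact: continuous_horner.
  have /cvgrPdist_le /(_ _ e2) h1 := cp.
  have h2 := op _ e2.
  near (0 : R)^'+ => u.
  have -> : p.[0] = (p.[0] - p.[u]) + p.[u] by rewrite subrK.
  rewrite (splitr e); apply: le_trans (ler_normD _ _) _; apply: lerD; first by near: u.
  apply: (@le_trans _ _ (e / 2 * u ^+ n.+1)); first by near: u.
  rewrite ler_piMr ?(ltW e2)// exprn_ile1//.
  by near: u; exact: nbhs_right_le.
have /factor_theorem[q pE] := p0.
rewrite subr0 in pE.
suff q0 : q = 0 by rewrite pE q0 mul0r.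
apply: ih.
  have [->|q0] := eqVneq q 0; first by rewrite size_poly0.
  by move: pn; rewrite pE size_mulX.
move=> e /op; apply: filterS2 (nbhs_right_gt 0) => u u0.
by rewrite pE hornerM hornerX normrM (gtr0_norm u0) exprSr mulrA ler_pM2r.
Unshelve. all: by end_near. Qed.

Lemma eq0_of_derivatives n W H : 0 < H ->
  (forall k u, (k < n)%N -> 0 < u < H -> is_derive u 1 (W k) (W k.+1 u)) ->
  (forall u, 0 < u < H -> W n u = 0) -> little_o_pow n.-1 (W 0%N) ->
  forall u, 0 < u < H -> W 0%N u = 0.
Proof.
move=> H0 dW Wn oW; case: n dW Wn oW => [//|n] dW Wn oW.
have [p pn pE] := poly_of_derivatives H0 dW Wn.
suff p0 : p = 0 by move=> u /pE ->; rewrite p0 horner0.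
apply: (little_o_poly0 pn) => e /oW h; near=> u.
rewrite -pE; first by near: u.
by apply/andP; split => //; near: u; exact: nbhs_right_lt.
Unshelve. all: by end_near. Qed.

End vanishing_order.

(** * Fractional integrals of nonnegative order *)

Section riemann_liouville_order0.
Context {R : realType}.
Implicit Types (phi : R -> R) (a b u : R).

(** The order [0] is the identity, as in the definition of the substantial
integral; this covers integral [alpha], for which [m - alpha = 0]. *)
Definition rli a phi : R -> R := if a == 0 then phi else rl a phi.

Lemma rli0 phi : rli 0 phi = phi. Proof. by rewrite /rli eqxx. Qed.

Lemma rliE a phi : 0 < a -> rli a phi = rl a phi.
Proof. by move=> a0; rewrite /rli gt_eqF. Qed.

Lemma continuous_rli a phi : 0 <= a -> continuous phi -> continuous (rli a phi).
Proof.
rewrite le_eqVlt => /predU1P[<-|a0] cphi; first by rewrite rli0.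
by rewrite rliE//; exact: continuous_rl.
Qed.

Lemma rli_semigroup a b phi : 0 <= a -> 0 <= b -> continuous phi ->
  rli a (rli b phi) = rli (a + b) phi.
Proof.
rewrite le_eqVlt => /predU1P[<-|a0]; first by rewrite add0r rli0.
rewrite le_eqVlt => /predU1P[<-|b0] cphi; first by rewrite addr0 rli0.
by rewrite !rliE ?addr_gt0//; apply/funext => u; exact: rl_semigroup.
Qed.

Lemma is_derive_rli a phi u : 0 <= a -> continuous phi -> 0 < u ->
  is_derive u 1 (rli (a + 1) phi) (rli a phi u).
Proof.
rewrite le_eqVlt => /predU1P[<-|a0] cphi u0.
  by rewrite add0r rli0 rliE//; exact: is_derive_rl1.
by rewrite !rliE ?addr_gt0//; exact: is_derive_rl.
Qed.

Lemma rliB a phi chi u : 0 <= a -> continuous phi -> continuous chi ->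
  rli a (fun v => phi v - chi v) u = rli a phi u - rli a chi u.
Proof.
rewrite le_eqVlt => /predU1P[<-|a0] cphi cchi; first by rewrite !rli0.
by rewrite !rliE// rlB.
Qed.

Lemma rli_inj0 a phi H : 0 <= a < 1 -> continuous phi ->
  (forall u, 0 < u < H -> rli a phi u = 0) -> forall u, 0 < u < H -> phi u = 0.
Proof.
move=> /andP[]; rewrite le_eqVlt => /predU1P[<-|a0] a1 cphi; first by rewrite rli0.
by rewrite rliE//; apply: rl_inj0; rewrite ?a0.
Qed.

Lemma little_o_rli n a phi : 0 <= a -> continuous phi ->
  little_o_pow n phi -> little_o_pow n (rli a phi).
Proof.
rewrite le_eqVlt => /predU1P[<-|a0] cphi; first by rewrite rli0.
rewrite rliE// => op e e0.
have G0 : 0 < Gamma (a + 1) by rewrite Gamma_gt0// addr_gt0.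
have /op[d' /= d'0 hd] : 0 < e * Gamma (a + 1) by rewrite mulr_gt0.
pose d : R := d'; have d0 : 0 < d := d'0.
near=> u.
have u0 : 0 < u by [].
have ud : u < d by near: u; exact: nbhs_right_lt.
have u1 : u <= 1 by near: u; exact: nbhs_right_le.
apply: le_trans (norm_rl_le (C := e * Gamma (a + 1) * u ^+ n) a0 cphi u0 _) _.
  move=> v /andP[v0 vu]; apply: (@le_trans _ _ (e * Gamma (a + 1) * v ^+ n)).
    apply: (hd v) => //=; rewrite sub0r normrN gtr0_norm//.
    exact: lt_trans ud.
  by rewrite ler_pM2l ?mulr_gt0// lerXn2r ?nnegrE// ltW.
have -> : e * Gamma (a + 1) * u ^+ n * (u `^ a / Gamma (a + 1)) = e * u ^+ n * u `^ a.
  by move: (Gamma (a + 1)) G0 => G G0; field; rewrite gt_eqF.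
rewrite ler_piMr ?mulr_ge0 ?exprn_ge0 ?(ltW e0) ?(ltW u0)//.
by rewrite -[leRHS](powRr0 u) ger_powR ?u0// ltW.
Unshelve. all: by end_near. Qed.

(** [I^(n + 1) phi] is in fact [O(u^(n + 1))], as [phi] is bounded near [0]. *)
Lemma little_o_rlS n phi : continuous phi -> little_o_pow n (rl n.+1%:R phi).
Proof.
move=> cphi e e0.
have [C C0 hC] := continuous_bounded_itv ler01 cphi.
have n0 : 0 < n.+1%:R :> R by [].
have G0 : 0 < Gamma (n.+1%:R + 1 : R) by rewrite Gamma_gt0// addr_gt0.
near=> u.
have u0 : 0 < u by [].
have u1 : u <= 1 by near: u; exact: nbhs_right_le.
have uC : u < e * Gamma (n.+1%:R + 1) / (C + 1).
  near: u; apply: nbhs_right_lt; rewrite divr_gt0 ?mulr_gt0//.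
  by rewrite ltr_wpDl.
apply: le_trans (norm_rl_le (C := C) n0 cphi u0 _) _.
  by move=> v /andP[v0 vu]; apply: hC; rewrite ltW//= (le_trans (ltW vu)).
rewrite powR_mulrn ?(ltW u0)// exprSr.
have -> : C * (u ^+ n * u / Gamma (n.+1%:R + 1)) = C * u / Gamma (n.+1%:R + 1) * u ^+ n.
  by ring.
rewrite ler_wpM2r ?exprn_ge0 ?(ltW u0)// ler_pdivrMr//.
have C1 : 0 < C + 1 by rewrite ltr_wpDl.
apply: (@le_trans _ _ ((C + 1) * u)); first by rewrite ler_pM2r// lerDl.
by rewrite mulrC -ler_pdivlMr// ltW.
Unshelve. all: by end_near. Qed.

End riemann_liouville_order0.

(** * Extension of functions continuous on a segment *)

Section extension.

Lemma continuous_comp_within (T U V : topologicalType) (A : set U) (c : T -> U)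
    (w : U -> V) :
  {within A, continuous w} -> continuous c -> (forall x, A (c x)) ->
  continuous (w \o c).
Proof.
move=> /subspace_continuousP cw cc Ac x.
apply: cvg_trans (cw (c x) (Ac x)) => B /= hB.
have : c y @[y --> x] --> within A (nbhs (c x)).
  move=> D hD; have hc : nbhs x (fun y => A (c y) -> D (c y)) := cc x _ hD.
  by apply: (@filterS _ (nbhs x) _ _ _ _ hc) => y hy; exact: (hy (Ac y)).
by move=> hc; exact: (hc _ hB).
Qed.

Context {R : realType}.
Implicit Types (w g : R -> R) (sigma rho h t u : R).

(** Composition with [clamp h] extends a function continuous on [`[0, h]] to a
continuous function on the whole line. *)
Definition clamp h t : R := Num.min (Num.max t 0) h.

Lemma continuous_clamp h : continuous (clamp h).
Proof.
move=> t; rewrite /clamp.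
have c0 : continuous (cst 0 : R -> R) by exact: cst_continuous.
have ch : continuous (cst h : R -> R) by exact: cst_continuous.
have cid : continuous (fun t : R => t) by move=> ?; exact: cvg_id.
exact: (continuous_min (continuous_max (cid t) (c0 t)) (ch t)).
Qed.

Lemma clamp_itv h t : 0 <= h -> 0 <= clamp h t <= h.
Proof. by move=> h0; rewrite /clamp ge_min lexx orbT le_min h0 le_max lexx orbT. Qed.

Lemma clamp_id h t : 0 <= t <= h -> clamp h t = t.
Proof. by move=> /andP[t0 th]; rewrite /clamp max_l// min_l. Qed.

Lemma unstraighten_extension sigma rho h w : 0 < rho -> 0 <= h ->
  (continuous (fun t => w (clamp h t))) ->
  exists2 phi, continuous phi &
    forall t, 0 <= t <= h -> w t = unstraighten sigma rho phi t.
Proof.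
move=> rho0 h0 cw.
exists (fun u => expR (sigma * u) * w (clamp h (Num.max u 0 `^ rho^-1))).
  move=> u; apply: cvgM.
    apply: (@continuous_comp _ _ _ (fun v => sigma * v) expR).
      by apply: cvgM; [exact: cvg_cst|exact: cvg_id].
    exact: continuous_expR.
  apply: (@continuous_comp _ _ _ (fun u : R => Num.max u 0 `^ rho^-1) (fun t => w (clamp h t))).
    by apply: continuous_max0_powR; rewrite invr_gt0.
  exact: cw.
move=> t th; have /andP[t0 _] := th.
rewrite /unstraighten max_l ?powR_ge0// powRK// clamp_id// mulrA -expRD.
by rewrite mulNr addNr expR0 mul1r.
Qed.

Lemma unstraightenK sigma rho phi u : 0 < rho -> 0 < u ->
  straighten sigma rho (unstraighten sigma rho phi) u = phi u.
Proof.
move=> rho0 u0; rewrite /straighten /unstraighten powR_invK// ?ltW// mulrA -expRD.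
by rewrite mulNr addrN expR0 mul1r.
Qed.

Lemma cvg_unstraighten0 sigma rho phi : 0 < rho -> continuous phi ->
  unstraighten sigma rho phi t @[t --> 0^'+] --> phi 0.
Proof.
move=> rho0 cphi; have -> : phi 0 = expR (- sigma * 0) * phi 0 by rewrite mulr0 expR0 mul1r.
have tp : t `^ rho @[t --> (0 : R)^'+] --> (0 : R) by exact: powR_cvg0.
apply: cvgM; last exact: (cvg_comp (fun t => t `^ rho) phi tp (cphi 0)).
have tsp : - sigma * t `^ rho @[t --> (0 : R)^'+] --> - sigma * 0.
  by apply: cvgM => //; exact: cvg_cst.
by apply: continuous_cvg; [exact: continuous_expR|exact: tsp].
Qed.

Lemma cvg_straighten0 sigma rho g (l : R) : 0 < rho ->
  g t @[t --> 0^'+] --> l -> straighten sigma rho g u @[u --> 0^'+] --> l.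
Proof.
move=> rho0 gl; have r0 : 0 < rho^-1 by rewrite invr_gt0.
have -> : l = expR (sigma * 0) * l by rewrite mulr0 expR0 mul1r.
apply: cvgM.
  apply: cvg_at_right_filter.
  apply: (@continuous_comp _ _ _ (fun v => sigma * v) expR).
    by apply: cvgM; [exact: cvg_cst|exact: cvg_id].
  exact: continuous_expR.
apply: cvg_comp gl => A [d /= d0 hA].
have tp : t `^ rho^-1 @[t --> (0 : R)^'+] --> (0 : R) by exact: powR_cvg0.
have /cvgrPdist_lt /(_ _ d0) hd := tp.
apply: filterS2 hd (nbhs_right_gt 0) => u hu u0.
by apply: hA => //=; exact: powR_gt0.
Qed.

End extension.

(** * Initial values and existence of iterated operators *)

Section initial_polynomial.
Context {R : realType}.

Lemma frac_order_itv (alpha : R) : 0 < alpha ->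
  [/\ (0 < frac_order alpha)%N, (frac_order alpha)%:R - 1 < alpha
    & alpha <= (frac_order alpha)%:R].
Proof.
move=> a0; have c0 : 0 < Num.ceil alpha by rewrite -ceil_gt0 in a0 *.
have E : (frac_order alpha)%:R = (Num.ceil alpha)%:~R :> R.
  by rewrite /frac_order -[in RHS](gtz0_abs c0).
have /andP[h1 h2] := ceil_itv alpha.
rewrite E; split => //; first by rewrite /frac_order absz_gt0 gt_eqF.
by move: h1; rewrite intrD.
Qed.

(** The Taylor polynomial, in the variable [u = t ^ rho], that has the prescribed
initial values. *)
Definition initial_poly (m : nat) (b : 'I_m -> R) : {poly R} :=
  \sum_(k < m) (b k / k`!%:R) *: 'X^k.

Lemma horner_initial_poly m (b : 'I_m -> R) x :
  (initial_poly b).[x] = \sum_(k < m) b k / k`!%:R * x ^+ k.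
Proof.
rewrite /initial_poly horner_sum; apply: eq_bigr => k _.
by rewrite hornerZ hornerXn.
Qed.

Lemma derivn_initial_poly0 m (b : 'I_m -> R) (k : 'I_m) :
  (initial_poly b)^`(k).[0] = b k.
Proof.
rewrite horner_coef0 coef_derivn addn0 ffactnn /initial_poly coef_sum.
rewrite (bigD1 k)//= big1 ?addr0 => [|j jk].
  by rewrite coefZ coefXn eqxx mulr1 -[LHS]mulr_natr divfK// pnatr_eq0 -lt0n fact_gt0.
by rewrite coefZ coefXn (inj_eq val_inj) eq_sym (negbTE jk) mulr0.
Qed.

End initial_polynomial.

Section operators.
Context {R : realType}.
Variables (sigma rho h : R).
Hypothesis rho0 : 0 < rho.

Lemma sD_exW k n g t : 0 < t <= h -> (k <= n)%N ->
  sD_ex sigma rho h n g t -> sD_ex sigma rho h k g t.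
Proof.
move=> th; elim: n k => [|n ih] k; first by rewrite leqn0 => /eqP ->.
rewrite leq_eqVlt => /predU1P[-> //|]; rewrite ltnS => kn [+ _].
rewrite near_withinE => /nbhs_singleton; rewrite /= in_itv/= => /(_ th).
exact: ih.
Qed.

Lemma sI_rli gam phi g : 0 <= gam -> continuous phi ->
  (forall s, 0 < s <= h -> g s = unstraighten sigma rho phi s) ->
  forall t, 0 < t <= h ->
    sI_ex sigma rho gam g t /\
    sI sigma rho gam g t = unstraighten sigma rho (rli gam phi) t.
Proof.
rewrite le_eqVlt => /predU1P[<-|gam0] cphi gE t th.
  by rewrite /sI_ex /sI eqxx rli0 gE.
have /andP[t0 tleh] := th.
have t0h : 0 <= t <= h by rewrite (ltW t0).
have [ig Eg] := sI_unstraighten rho0 gam0 cphi gE t0h.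
by rewrite /sI_ex /sI gt_eqF// rliE.
Qed.

End operators.

(** * Equivalence of the two problems *)

Section equivalence.
Context {R : realType}.
Variables (sigma rho alpha h : R).
Variables (b : 'I_(frac_order alpha) -> R) (f : R * R -> R) (psi G : R -> R).
Hypotheses (rho0 : 0 < rho) (alpha0 : 0 < alpha) (h0 : 0 < h).
Hypothesis cpsi : {within `[0, h], continuous psi}.
Hypothesis cG : continuous G.
Hypothesis GE : forall t, 0 <= t <= h -> f (t, psi t) = unstraighten sigma rho G t.

Let m := frac_order alpha.
Let p := initial_poly b.
Let gam := m%:R - alpha.

Let gam_ge0 : 0 <= gam.
Proof. by rewrite subr_ge0; have [] := frac_order_itv alpha0. Qed.

Let gam_lt1 : gam < 1.
Proof. by rewrite /gam ltrBlDr -ltrBlDl; have [] := frac_order_itv alpha0. Qed.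

Let pow_rhoX t (k : nat) : t `^ (rho * k%:R) = (t `^ rho) ^+ k.
Proof. by rewrite powRrM powR_mulrn// powR_ge0. Qed.

Lemma volterra_rhsE t : 0 <= t <= h ->
  expR (- sigma * t `^ rho) *
    (\sum_(k < frac_order alpha) b k / Gamma (k%:R + 1) * t `^ (rho * k%:R))
  + rho / Gamma alpha *
    \int[lebesgue_measure]_(s in `[0, t])
      (expR (- sigma * (t `^ rho - s `^ rho))
       / (t `^ rho - s `^ rho) `^ (1 - alpha)
       * s `^ (rho - 1) * f (s, psi s))
  = unstraighten sigma rho (fun u => p.[u] + rl alpha G u) t.
Proof.
move=> th; rewrite /unstraighten mulrDr; congr (_ + _).
  congr (_ * _); rewrite horner_initial_poly; apply: eq_bigr => k _.
  by rewrite Gamma_nat pow_rhoX.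
have GE' s : 0 < s <= h -> f (s, psi s) = unstraighten sigma rho G s.
  by move=> /andP[s0 sh]; rewrite GE// (ltW s0).
have [_ E] := sI_unstraighten rho0 alpha0 cG GE' th.
rewrite -[RHS]E; congr (_ * _); apply: eq_Rintegral => s _.
rewrite /sI_integrand -(opprB alpha 1) powRN invrK.
by congr (_ * _ * _); rewrite mulrC.
Qed.

Lemma caputo_remainderE t :
  (forall k : 'I_(frac_order alpha), sD_at0 sigma rho h k psi = b k) ->
  caputo_remainder sigma rho h alpha psi t =
  psi t - unstraighten sigma rho (horner p) t.
Proof.
move=> bE; rewrite /caputo_remainder /unstraighten horner_initial_poly mulr_sumr.
congr (_ - _); apply: eq_bigr => k _.
by rewrite bE pow_rhoX mulrC.
Qed.

(** Differentiate [p + I^alpha G] fewer than [m] times to read off the initial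
values, and [I^m G] exactly [m] times to obtain the differential equation. *)
Lemma ivp_of_volterra :
  (forall t, 0 <= t <= h ->
    psi t = unstraighten sigma rho (fun u => p.[u] + rl alpha G u) t) ->
  ivp_solution sigma rho h b f psi.
Proof.
move=> psiE; have [_ am _] := frac_order_itv alpha0.
have psiE' t : 0 < t <= h ->
    psi t = unstraighten sigma rho (fun u => p.[u] + rl alpha G u) t.
  by move=> /andP[t0 th]; rewrite psiE// (ltW t0).
(* Phi k is the k-th derivative of p + I^alpha G, for k < m. *)
pose Phi k u := (p^`(k)).[u] + rli (alpha - k%:R) G u.
have Phi0E : Phi 0%N = (fun u => p.[u] + rl alpha G u).
  by apply/funext => u; rewrite /Phi derivn0 subr0 rliE.
have ak k : (k < m)%N -> 0 < alpha - k%:R.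
  move=> km; have : k%:R <= m%:R - 1 :> R by rewrite lerBrDr natr1 ler_nat.
  by rewrite subr_gt0 => /le_lt_trans; apply.
have dPhi k (u : R) : (k.+1 < m)%N -> 0 < u -> is_derive u 1 (Phi k) (Phi k.+1 u).
  move=> km u0; have a1 := ltW (ak _ km).
  have dp := is_derive_poly p^`(k) u.
  have dr := is_derive_rli a1 cG u0.
  rewrite (_ : alpha - k.+1%:R + 1 = alpha - k%:R) in dr; last first.
    by rewrite -natr1; ring.
  by rewrite /Phi derivnS; exact: (is_deriveD dp dr).
have sDE k t : (k < m)%N -> 0 < t <= h ->
    sD_ex sigma rho h k psi t /\ sD sigma rho h k psi t = unstraighten sigma rho (Phi k) t.
  move=> km; apply: (@sD_unstraighten _ sigma rho h rho0 k psi Phi).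
    by move=> j u jk; exact: dPhi (leq_ltn_trans jk km).
  by move=> s sh; rewrite psiE'// Phi0E.
have near_h : \forall t \near 0^'+, 0 < t <= h.
  by near=> t; apply/andP; split => //; near: t; exact: nbhs_right_le.
have cPhi k : (k < m)%N -> continuous (Phi k).
  move=> km u; apply: cvgD; first exact: continuous_horner.
  by apply: continuous_rli => //; exact: ltW (ak _ km).
have lim0 (k : 'I_m) : sD sigma rho h k psi t @[t --> 0^'+] --> b k.
  have -> : b k = Phi k 0.
    by rewrite /Phi derivn_initial_poly0 rliE ?ak// rl_le0// addr0.
  apply: cvg_trans (cvg_unstraighten0 sigma rho0 (cPhi k (ltn_ord k))).
  apply: near_eq_cvg; apply: filterS near_h => t th.
  by have [_ ->] := sDE k t (ltn_ord k) th.
have at0E (k : 'I_m) : sD_at0 sigma rho h k psi = b k by exact: cvg_lim (lim0 k).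
have at0ex (k : 'I_m) : sD_at0_ex sigma rho h k psi.
  split; last by apply/cvg_ex; exists (b k).
  apply: filterS near_h => t th.
  by have [] := sDE k t (ltn_ord k) th.
have remE s : 0 < s <= h -> caputo_remainder sigma rho h alpha psi s =
    unstraighten sigma rho (rl alpha G) s.
  by move=> sh; rewrite caputo_remainderE// psiE'// /unstraighten; ring.
have sIE := sI_rli rho0 gam_ge0 (continuous_rl alpha0 cG) remE.
have rliE' k : (k <= m)%N -> 0 <= m%:R - k%:R :> R.
  by move=> km; rewrite subr_ge0 ler_nat.
have capE t : 0 < t <= h ->
    sD_ex sigma rho h m (sI sigma rho gam (caputo_remainder sigma rho h alpha psi)) t /\
    sD sigma rho h m (sI sigma rho gam (caputo_remainder sigma rho h alpha psi)) t =
    unstraighten sigma rho G t.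
  move=> th; have -> : G = rli (m%:R - m%:R) G by rewrite subrr rli0.
  apply: (@sD_unstraighten _ sigma rho h rho0 m _ (fun k => rli (m%:R - k%:R) G)) => //.
    move=> k u km u0; have dr := is_derive_rli (rliE' _ km) cG u0.
    rewrite (_ : m%:R - k.+1%:R + 1 = m%:R - k%:R) in dr; first exact: dr.
    by rewrite -natr1; ring.
  move=> s sh; have [_ ->] := sIE s sh.
  have -> : rl alpha G = rli alpha G by rewrite rliE.
  rewrite (rli_semigroup gam_ge0 (ltW alpha0) cG).
  by have -> : gam + alpha = m%:R - 0%:R by rewrite /gam subrK subr0.
split; [exact: cpsi| |by move=> k; split].
move=> t th.
have [cex cE] := capE t th; split; last first.
  rewrite GE; last by have /andP[/ltW -> ->] := th.
  exact: cE.
split=> //; split; last exact: cex.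
rewrite near_withinE; apply: nearW => s; rewrite /= in_itv/= => sh.
by have [] := sIE s sh.
Unshelve. all: by end_near. Qed.

(** The integrals [I^(m - alpha) N] and [I^m G], where [N] is [Psi] minus its initial
polynomial, have the same [m]-th derivative and are both [o(u^(m - 1))], hence
coincide; [I^(m - alpha)] is then cancelled. *)
Lemma volterra_of_ivp (Psi : R -> R) : continuous Psi ->
  (forall t, 0 <= t <= h -> psi t = unstraighten sigma rho Psi t) ->
  ivp_solution sigma rho h b f psi ->
  forall t, 0 <= t <= h ->
    psi t = unstraighten sigma rho (fun u => p.[u] + rl alpha G u) t.
Proof.
move=> cPsi psiE [_ de ic]; have [m0 _ _] := frac_order_itv alpha0.
have hge0 := ltW h0; have H0 : 0 < h `^ rho by exact: powR_gt0.
have at0E (k : 'I_m) : sD_at0 sigma rho h k psi = b k by have [_ ->] := ic k.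
pose N u := Psi u - p.[u].
have cN : continuous N.
  by move=> u; apply: cvgB; [exact: cPsi|exact: continuous_horner].
have remE s : 0 < s <= h -> caputo_remainder sigma rho h alpha psi s =
    unstraighten sigma rho N s.
  move=> /andP[s0 sh]; rewrite caputo_remainderE// psiE ?(ltW s0)//.
  by rewrite /unstraighten /N mulrBr.
have sIE := sI_rli rho0 gam_ge0 cN remE.
pose S := sI sigma rho gam (caputo_remainder sigma rho h alpha psi).
have SE t : 0 < t <= h ->
    sD_ex sigma rho h m S t /\ sD sigma rho h m S t = unstraighten sigma rho G t.
  move=> th; have [[_ [_ ex]] E] := de t th; split; first exact: ex.
  by rewrite -GE; [exact: E|have /andP[/ltW -> ->] := th].
(* By the initial conditions, N and its first m - 1 derivatives tend to 0. *)
have oN : little_o_pow m.-1 N.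
  have mlt : (m.-1 < m)%N by rewrite prednK.
  have [[exd _] _] := ic (Ordinal mlt); move: exd => [d' /= d'0 hd].
  (* The derivatives of psi are only known to exist near 0, hence d. *)
  pose d : R := Num.min d' h; have d0 : 0 < d by rewrite lt_min h0 andbT; exact: d'0.
  have dh : d <= h by rewrite ge_min lexx orbT.
  have dd' : d <= d' by rewrite ge_min lexx.
  have D0 : 0 < d `^ rho by exact: powR_gt0.
  have Dh : d `^ rho <= h `^ rho.
    by rewrite ge0_ler_powR ?nnegrE ?(ltW rho0) ?(ltW d0) ?(ltW h0).
  pose Nk k u := straighten sigma rho (sD sigma rho h k psi) u - (p^`(k)).[u].
  apply: (@eq_little_o _ _ (Nk 0%N)).
    near=> u; have u0 : 0 < u by [].
    have uH : u < h `^ rho by near: u; exact: nbhs_right_lt.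
    have uh : 0 < u < h `^ rho by rewrite u0.
    have /andP[t0 th] := powR_inv_itv rho0 uh hge0.
    rewrite /Nk derivn0 /N /straighten /=; congr (_ - _).
    rewrite psiE ?(ltW t0) ?(ltW th)//.
    exact: (unstraightenK sigma Psi rho0 u0).
  apply: (little_o_of_derivatives D0).
    move=> k u km /andP[u0 ud].
    have uh : 0 < u < h `^ rho by rewrite u0 (lt_le_trans ud).
    have ud' : 0 < u < d `^ rho by rewrite u0.
    have /andP[t0 td] := powR_inv_itv rho0 ud' (ltW d0).
    have ext : sD_ex sigma rho h k.+1 psi (u `^ rho^-1).
      apply: (@sD_exW _ sigma rho h k.+1 m.-1) => //.
        by rewrite t0 (le_trans (ltW td)).
      apply: hd => //=; rewrite sub0r normrN gtr0_norm//.
      exact: lt_le_trans td dd'.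
    have ds := is_derive_straighten_sD rho0 hge0 uh ext.
    have dp := is_derive_poly p^`(k) u.
    by rewrite /Nk derivnS; exact: (is_deriveB ds dp).
  move=> k km; have km' : (k < m)%N by rewrite (leq_ltn_trans km).
  have [[_ cvk] limk] := ic (Ordinal km').
  suff : Nk k u @[u --> 0^'+] --> b (Ordinal km') - (p^`(k)).[0].
    by rewrite /p (derivn_initial_poly0 b (Ordinal km')) subrr.
  apply: cvgB.
    have cvb : sD sigma rho h k psi t @[t --> 0^'+] --> b (Ordinal km').
      by rewrite -limk; exact: cvk.
    exact: (cvg_straighten0 sigma rho0 cvb).
  by apply: cvg_at_right_filter; exact: continuous_horner.
(* W k is the k-th derivative of I^(m - alpha) N - I^m G; the differential
   equation says that W m vanishes. *)
pose W k u := straighten sigma rho (sD sigma rho h k S) u - rli (m%:R - k%:R) G u.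
have W0E u : 0 < u < h `^ rho -> W 0%N u = rli gam N u - rl m%:R G u.
  move=> uh; have /andP[u0 _] := uh; have /andP[t0 th] := powR_inv_itv rho0 uh hge0.
  have th' : 0 < u `^ rho^-1 <= h by rewrite t0 ltW.
  rewrite /W subr0 rliE ?ltr0n//; congr (_ - _).
  rewrite /straighten /= /S (sIE _ th').2.
  exact: (unstraightenK sigma (rli gam N) rho0 u0).
have W0 u : 0 < u < h `^ rho -> W 0%N u = 0.
  move: u; apply: (@eq0_of_derivatives _ m) => //.
  - move=> k u km uh; have /andP[u0 _] := uh.
    have /andP[t0 th] := powR_inv_itv rho0 uh hge0.
    have th' : 0 < u `^ rho^-1 <= h by rewrite t0 ltW.
    have ds := is_derive_straighten_sD rho0 hge0 uh (sD_exW th' km (SE _ th').1).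
    have mk : 0 <= m%:R - k.+1%:R :> R by rewrite subr_ge0 ler_nat.
    have dr := is_derive_rli mk cG u0.
    rewrite (_ : m%:R - k.+1%:R + 1 = m%:R - k%:R) in dr; last first.
      by rewrite -natr1; ring.
    exact: (is_deriveB ds dr).
  - move=> u uh; have /andP[u0 _] := uh.
    have /andP[t0 th] := powR_inv_itv rho0 uh hge0.
    have th' : 0 < u `^ rho^-1 <= h by rewrite t0 ltW.
    rewrite /W subrr rli0 {1}/straighten (SE _ th').2.
    apply/eqP; rewrite subr_eq0; apply/eqP.
    exact: (unstraightenK sigma G rho0 u0).
  - apply: (@eq_little_o _ _ (fun u => rli gam N u - rl m%:R G u)).
      near=> v; have v0 : 0 < v by [].
      have vH : v < h `^ rho by near: v; exact: nbhs_right_lt.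
      by rewrite W0E// v0.
    apply: little_oB; first exact: little_o_rli.
    by have := @little_o_rlS _ m.-1 _ cG; rewrite prednK.
(* I^(m - alpha) N = I^m G = I^(m - alpha) I^alpha G, and I^(m - alpha) is
   injective. *)
have NE u : 0 < u < h `^ rho -> N u - rl alpha G u = 0.
  have cr := continuous_rl alpha0 cG.
  move: u; apply: (@rli_inj0 _ gam); first by rewrite gam_ge0.
    by move=> u; apply: cvgB; [exact: cN|exact: cr].
  move=> u uh; rewrite (rliB _ gam_ge0 cN cr) -(W0 u uh) (W0E u uh); congr (_ - _).
  have -> : rl alpha G = rli alpha G by rewrite rliE.
  rewrite (rli_semigroup gam_ge0 (ltW alpha0) cG).
  have -> : gam + alpha = m%:R by rewrite /gam subrK.
  by rewrite rliE// ltr0n.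
move=> t th; have /andP[t0 tleh] := th; rewrite (psiE t th) /unstraighten; congr (_ * _).
have Nt : N (t `^ rho) - rl alpha G (t `^ rho) = 0.
  apply: (@eq0_itv_closure _ (fun u => N u - rl alpha G u) _ _ H0 _ NE).
    by move=> u; apply: cvgB; [exact: cN|exact: (continuous_rl alpha0 cG)].
  by rewrite powR_ge0 ge0_ler_powR ?nnegrE ?(ltW rho0).
by move/eqP: Nt; rewrite subr_eq0 => /eqP <-; rewrite /N addrC subrK.
Unshelve. all: by end_near. Qed.

End equivalence.

Theorem theorem9 (R : realType) (sigma rho alpha h : R)
    (b : 'I_(frac_order alpha) -> R) (f : R * R -> R) (psi : R -> R)
    (hsigma : 0 < sigma) (hrho : 0 < rho) (halpha : 0 < alpha) (hh : 0 < h)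
    (hf : {within `[0, +oo[ `*` [set: R], continuous f}) :
  ivp_solution sigma rho h b f psi <->
  ({within `[0, h], continuous psi} /\
   forall t, 0 <= t <= h ->
     psi t =
       expR (- sigma * t `^ rho) *
         (\sum_(k < frac_order alpha) b k / Gamma (k%:R + 1) * t `^ (rho * k%:R))
       + rho / Gamma alpha *
         \int[lebesgue_measure]_(s in `[0, t])
           (expR (- sigma * (t `^ rho - s `^ rho))
            / (t `^ rho - s `^ rho) `^ (1 - alpha)
            * s `^ (rho - 1) * f (s, psi s))).
Proof.
have h0 := ltW hh.
have ext : {within `[0, h], continuous psi} -> exists Psi G,
    [/\ continuous Psi, continuous G,
        forall t, 0 <= t <= h -> psi t = unstraighten sigma rho Psi t
      & forall t, 0 <= t <= h -> f (t, psi t) = unstraighten sigma rho G t].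
  move=> cpsi; have ccl := @continuous_clamp R h.
  have clampA t : `[0, h]%classic (clamp h t) by rewrite /= in_itv/= clamp_itv.
  have cpsi' := continuous_comp_within cpsi ccl clampA.
  have cpair : continuous (fun t => (clamp h t, psi (clamp h t))).
    by move=> t; exact: (cvg_pair (ccl t) (cpsi' t)).
  have cf : continuous (fun t => f (clamp h t, psi (clamp h t))).
    apply: (continuous_comp_within hf cpair) => t; split=> //=.
    by have /andP[] := clamp_itv t h0; rewrite in_itv/= andbT.
  have [Psi cPsi PsiE] := unstraighten_extension sigma hrho h0 cpsi'.
  have [G cG GE] :=
    @unstraighten_extension _ sigma rho h (fun t => f (t, psi t)) hrho h0 cf.
  by exists Psi, G.
split=> [H|[cpsi H]].
  have [cpsi _ _] := H; have [Psi [G [cPsi cG PsiE GE]]] := ext cpsi.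
  split=> [|t th]; first exact: cpsi.
  rewrite (volterra_rhsE b hrho halpha cG GE th).
  exact: (volterra_of_ivp hrho halpha hh cG GE cPsi PsiE H).
have [_ [G [_ cG _ GE]]] := ext cpsi.
apply: (ivp_of_volterra hrho halpha hh cpsi cG GE) => t th.
by rewrite (H t th) (volterra_rhsE b hrho halpha cG GE th).
Qed.
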